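(* Let $(\Omega,\mu)$ be a totally $\sigma$-finite measure space with a non-atomic measure $\mu$. Let $0<\theta<1$, $1<p_0<p_1<\infty$, $0<r,r_0,r_1,q_0,q_1\le\infty$, $b_0,b_1\in SV$, $\left\|s^{-1/r_0}b_0(s)\right\|_{r_0,(1,\infty)}<\infty$, and $\left\|s^{-1/r_1}b_1(s)\right\|_{r_1,(1,\infty)}<\infty$. Put $c_0(t)=\left\|s^{-1/r_0}b_0(s)\right\|_{r_0,(t,\infty)}$ and $c_1(t)=\left\|s^{-1/r_1}b_1(s)\right\|_{r_1,(t,\infty)}$ for $t>0$. Then $$\left(L^{(p_0,q_0,r_0)}_{b_0},L^{(p_1,q_1,r_1)}_{b_1}\right)_{\theta,r}\cong L_{p,r,a^{\#}},$$ where $\frac1p=\frac{1-\theta}{p_0}+\frac{\theta}{p_1}$ and $a^{\#}(t)=c_0(t)^{1-\theta}c_1(t)^{\theta}$. Here $L^{(p_i,q_i,r_i)}_{b_i}$ denote small Lorentz spaces.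
   Context: All function spaces are over $(\Omega,\mu)$; $f^*$ denotes the non-increasing rearrangement of a $\mu$-measurable function $f$ on $\Omega$. $\|\cdot\|_{q,(c,d)}$ ($0<q\le\infty$) is the usual (quasi-)norm of the Lebesgue space $L_q$ on the interval $(c,d)$ with Lebesgue measure (variable of integration: the displayed variable; $1/\infty=0$). $SV$ is the set of positive Lebesgue measurable functions $b$ on $(0,\infty)$ that are slowly varying: for each $\varepsilon>0$, $t^{\varepsilon}b(t)$ is equivalent to an increasing function and $t^{-\varepsilon}b(t)$ is equivalent to a decreasing function, where two positive functions are equivalent if each is bounded by a constant multiple of the other. The Lorentz–Karamata space $L_{p,q,b}$ (also written $L_{p,q;b}$; $0<p,q\le\infty$, $b\in SV$) is the set of $\mu$-measurable $f$ with $\left\|t^{\frac1p-\frac1q}b(t)f^*(t)\right\|_{q,(0,\infty)}<\infty$. The small Lorentz space $L^{(p,q,r)}_{b}$ ($0<p<\infty$, $0<q,r\le\infty$, $b\in SV$) is the set of $\mu$-measurable $f$ with $\left\|t^{-\frac1r}b(t)\left\|u^{\frac1p-\frac1q}f^*(u)\right\|_{q,(0,t)}\right\|_{r,(0,\infty)}<\infty$. For a compatible couple $(X_0,X_1)$ of (quasi-)Banach spaces, $(X_0,X_1)_{\theta,r}$ is the classical real interpolation space of $f\in X_0+X_1$ with $\left\|u^{-\theta-1/r}K(u,f)\right\|_{r,(0,\infty)}<\infty$, $K(u,f)=\inf\{\|f_0\|_{X_0}+u\|f_1\|_{X_1}: f=f_0+f_1,\ f_i\in X_i\}$. $X\cong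 Y$ means that $X$ and $Y$ are continuously embedded in each other (same space, equivalent quasi-norms). *)

(* Defs.v *)
From HB Require Import structures.
From mathcomp Require Import all_boot all_order all_algebra.
From mathcomp Require Import all_classical all_reals all_analysis.

Set Implicit Arguments.
Unset Strict Implicit.
Unset Printing Implicit Defensive.

Import Order.TTheory GRing.Theory Num.Theory.
Import numFieldNormedType.Exports.

Local Open Scope classical_set_scope.
Local Open Scope ring_scope.
Local Open Scope ereal_scope.

(* The real line with the Lebesgue (i.e. completed Borel) sigma-algebra; this is
   the domain of completed_lebesgue_measure. *)
Definition lebesgueTypeR (R : realType) :=
  caratheodory_type (@wlength R idfun)^*%mu.

(* [fine q^-1] below is 1/q with the convention 1/oo = 0 (0 < q <= oo). *)

Section interval_norms.
Context {R : realType}.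
Implicit Types (q r : \bar R) (D : set R) (h : R -> \bar R) (b : R -> R).

(* ||h||_{q,D}: h is extended by 0 outside D, which changes neither the
   integral nor, for q = +oo, the essential supremum of |h| over a set D of
   positive measure. *)
Definition normL q D h : \bar R :=
  'N[ @completed_lebesgue_measure R ]_q [ h \_ D ].

Definition tail_norm r b (t : R) : \bar R :=
  normL r `]t, +oo[ (fun s => (s `^ (- fine r^-1) * b s)%:E).

Definition equivalent (f g : R -> R) : Prop :=
  exists2 C : R, (0 < C)%R &
    forall t : R, (0 < t)%R -> (f t <= C * g t)%R /\ (g t <= C * f t)%R.

(* The class SV; functions on (0,oo) are total functions on R whose values
   outside `]0, +oo[ are never used. *)
Definition slowly_varying b : Prop :=
  [/\ forall t : R, (0 < t)%R -> (0 < b t)%R,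
      @measurable_fun _ _ (lebesgueTypeR R) (measurableTypeR R) `]0%R, +oo[ b,
      forall e : R, (0 < e)%R -> exists2 g : R -> R,
        {in `]0%R, +oo[ &, {homo g : x y / (x <= y)%R}} &
        equivalent (fun t => t `^ e * b t)%R g &
      forall e : R, (0 < e)%R -> exists2 g : R -> R,
        {in `]0%R, +oo[ &, {homo g : x y / (x <= y)%R >-> (y <= x)%R}} &
        equivalent (fun t => t `^ (- e) * b t)%R g].

End interval_norms.

(* A function space: a set of functions together with a quasi-norm (only
   meaningful on that set). Functions are not quotiented by a.e. equality. *)
Record qspace (R : realType) (T : Type) := QSpace {
  carrier :> set (T -> R);
  qnorm : (T -> R) -> \bar R }.

Definition embedded (R : realType) (T : Type) (X Y : qspace R T) : Prop :=
  exists2 C : R, (0 < C)%R &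
    forall f, carrier X f -> carrier Y f /\ qnorm Y f <= C%:E * qnorm X f.

Definition same_space (R : realType) (T : Type) (X Y : qspace R T) : Prop :=
  embedded X Y /\ embedded Y X.

Section function_spaces.
Context {d : measure_display} {T : measurableType d} {R : realType}.
Variable mu : {measure set T -> \bar R}.
Implicit Types (f : T -> R) (q r : \bar R) (b : R -> R) (X : qspace R T).

Definition nonatomic : Prop :=
  forall A, measurable A -> 0 < mu A ->
    exists B, [/\ measurable B, B `<=` A, 0 < mu B & mu B < mu A].

(* f^*(t); the value is +oo when no level l is admissible. *)
Definition rearrangement f (t : R) : \bar R :=
  ereal_inf [set l%:E | l in
    [set l : R | (0 <= l)%R /\ mu [set x | (l < `|f x|)%R] <= t%:E]].

Definition LK_norm (p : \bar R) q b f : \bar R :=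
  normL q `]0%R, +oo[
    (fun t => (t `^ (fine p^-1 - fine q^-1) * b t)%:E * rearrangement f t).

Definition Lorentz_Karamata (p : \bar R) q b : qspace R T :=
  QSpace [set f | measurable_fun setT f /\ LK_norm p q b f < +oo]
         (LK_norm p q b).

Definition small_Lorentz_norm (p : R) q r b f : \bar R :=
  normL r `]0%R, +oo[
    (fun t => (t `^ (- fine r^-1) * b t)%:E *
      normL q `]0%R, t[
        (fun u => (u `^ (p^-1 - fine q^-1))%:E * rearrangement f u)).

Definition small_Lorentz (p : R) q r b : qspace R T :=
  QSpace [set f | measurable_fun setT f /\ small_Lorentz_norm p q r b f < +oo]
         (small_Lorentz_norm p q r b).

Definition decomposition X0 X1 f (g : (T -> R) * (T -> R)) : Prop :=
  [/\ carrier X0 g.1, carrier X1 g.2 &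
      {ae mu, forall x, f x = (g.1 x + g.2 x)%R}].

Definition Kfun X0 X1 (u : R) f : \bar R :=
  ereal_inf [set qnorm X0 g.1 + u%:E * qnorm X1 g.2
            | g in decomposition X0 X1 f].

Definition interpolation_norm X0 X1 (theta : R) r f : \bar R :=
  normL r `]0%R, +oo[
    (fun u => (u `^ (- theta - fine r^-1))%:E * Kfun X0 X1 u f).

Definition real_interpolation X0 X1 (theta : R) r : qspace R T :=
  QSpace [set f | [/\ measurable_fun setT f,
                      exists g, decomposition X0 X1 f g &
                      interpolation_norm X0 X1 theta r f < +oo]]
         (interpolation_norm X0 X1 theta r).

End function_spaces.

(* Main.v *)
(* Everything is read off at the points 2^k, k an integer.  Put f_k = f^*(2^k).
   The tail norm of b_i is 2^(u_i k) up to constants at 2^k, where u_i varies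
   more slowly than any nonzero multiple of k.  In X_i = L^{(p_i,q_i,r_i)}_{b_i}
   the norm dominates 2^(k/p_i + u_i k) f_k for every k; it is at most a
   multiple of A 2^(k/p_i + u_i k) as soon as, for all l,
   2^(l/p_i) f_l <= A 2^(k/p_i) 2^(-e|l-k|).  So q_i, r_i and b_i matter only
   through u_i.

   Let w_k = 2^(k(1/p_0 - 1/p_1) + u_0 k - u_1 k) and let y_k be the value of
   t^(1/p) a#(t) f^*(t) at t = 2^k; both are taken up to constants.
   - From f^*(s + t) <= g^*(s) + h^*(t) we get y_k <= C w_k^(-theta) K(w_k, f).
   - Truncating f at height f_k, where w_k is comparable to 2^j, we get
     2^(-j theta) K(2^j, f) <= C sup_l 2^(-d|l-k|) y_l.
   Since k(1/p_0 - 1/p_1) is the main term of log w_k, the indices j and k are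
   related by a quasi-isometry of the integers; a Schur test for geometrically
   decaying kernels, valid in l^r for every 0 < r <= oo because it only involves
   suprema and sums of r-th powers, then compares the two l^r norms. *)
Require Import Defs.
From HB Require Import structures.
From mathcomp Require Import all_boot all_order all_algebra.
From mathcomp Require Import all_classical all_reals all_analysis.
From mathcomp Require Import measurable_realfun ess_sup_inf zify ring lra.

Set Implicit Arguments.
Unset Strict Implicit.
Unset Printing Implicit Defensive.

Import Order.TTheory GRing.Theory Num.Theory.
Import numFieldNormedType.Exports.

Local Open Scope classical_set_scope.
Local Open Scope ring_scope.

(** * Dyadic intervals *)

Section dyadic.
Context {R : realType}.
Implicit Types (x y : R) (k l : int).

(** Neither K(t, f) nor the inner norm is ever shown to be measurable in t. Integrands are only
    sandwiched, on each [2^k, 2^(k+1)), between multiples of t^(-1/r); from there on all comparisons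
    are between sequences on the integers. A tail of b_i appears because the inner norm over (0, t)
    sees the scale 2^k as soon as t >= 2^k. By monotonicity of f^* it is then at least a multiple of
    2^(k/p_i) f_k, and what remains is the outer norm of b_i beyond 2^k. The truncated pieces decay
    away from 2^k at the rates theta (1/p_0 - 1/p_1) and (1 - theta)(1/p_0 - 1/p_1), and the bounded
    piece decays below 2^k at the rate 1/p_1. All three are positive, and a fraction of the smallest
    is given up to absorb the slowly varying factors and the Schur test. Terms may be infinite, so
    suprema are handled through their real upper bounds A. Weights are powers of 2 with real
    exponents, which turns estimates on weights into linear inequalities. *)

Definition pow2 x : R := 2 `^ x.

Lemma pow2_gt0 x : 0 < pow2 x. Proof. exact: powR_gt0. Qed.

Lemma pow2_ge0 x : 0 <= pow2 x. Proof. exact: powR_ge0. Qed.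

Lemma pow2_0 : pow2 0 = 1. Proof. exact: powRr0. Qed.

Lemma pow2_1 : pow2 1 = 2. Proof. exact: powRr1. Qed.

Lemma pow2D x y : pow2 (x + y) = pow2 x * pow2 y.
Proof. by rewrite /pow2 powRD// pnatr_eq0 implybT. Qed.

Lemma pow2N x : pow2 (- x) = (pow2 x)^-1. Proof. exact: powRN. Qed.

Lemma pow2_powR x y : pow2 x `^ y = pow2 (x * y).
Proof. by rewrite /pow2 powRrM. Qed.

Lemma ler_pow2 : {mono pow2 : x y / x <= y}.
Proof.
apply: le_mono => x y xy; rewrite /pow2 /powR gt_eqF//.
by rewrite ltr_expR ltr_pM2r// ln_gt0// ltr1n.
Qed.

Lemma ltr_pow2 : {mono pow2 : x y / x < y}.
Proof. exact: (leW_mono ler_pow2). Qed.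

Definition dlog x : int := Num.floor (ln x / ln 2).

Definition dyadic k : set R := `[pow2 k%:~R, pow2 (k + 1)%:~R[.

Lemma dyadicP k x : dyadic k x <-> pow2 k%:~R <= x < pow2 (k + 1)%:~R.
Proof. by rewrite /dyadic /= in_itv. Qed.

Lemma pow2_log x : 0 < x -> pow2 (ln x / ln 2) = x.
Proof.
move=> x0; rewrite /pow2 /powR gt_eqF// divfK ?lnK//.
by rewrite gt_eqF// ln_gt0// ltr1n.
Qed.

Lemma dyadic_dlog x : 0 < x -> dyadic (dlog x) x.
Proof.
move=> x0; apply/dyadicP;
  rewrite -[in leRHS](pow2_log x0) -[ltLHS](pow2_log x0).
by rewrite ler_pow2 ltr_pow2 floor_itv.
Qed.

Lemma dyadic_gt0 k x : dyadic k x -> 0 < x.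
Proof. by move=> /dyadicP/andP[+ _]; exact/lt_le_trans/pow2_gt0. Qed.

Lemma dyadic_inj k x : dyadic k x -> k = dlog x.
Proof.
move=> kx; have x0 := dyadic_gt0 kx; apply/esym/floor_def.
by rewrite -ler_pow2 -ltr_pow2 !pow2_log//; exact/dyadicP.
Qed.

Lemma dyadic_pow2 k : dyadic k (pow2 k%:~R).
Proof. by apply/dyadicP; rewrite lexx ltr_pow2 ltr_int ltrDl. Qed.

Lemma measurable_dyadic k :
  measurable (dyadic k : set (lebesgueTypeR R)).
Proof. by apply: sub_caratheodory; exact: measurable_itv. Qed.

Lemma dyadic_measure k :
  @completed_lebesgue_measure R (dyadic k) = (pow2 k%:~R)%:E.
Proof.
have -> : @completed_lebesgue_measure R (dyadic k) =
   @lebesgue_measure R (dyadic k) by [].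
rewrite lebesgue_measure_itv/= lte_fin ltr_pow2 ltr_int ltrDl ltr01.
by rewrite -EFinB rmorphD/= pow2D pow2_1; congr EFin; ring.
Qed.

End dyadic.

(** * Dyadic discretization of integral norms *)

Section esum_integral.
Local Open Scope ereal_scope.
Context {R : realType}.

(** Enumerating [I] by [pickle] gives a series over the naturals, the form to which monotone
    convergence applies; codes of no element contribute 0. *)
Lemma esum_countType {I : countType} (a : I -> \bar R) : (forall i, 0 <= a i) ->
  \esum_(i in setT) a i =
  \sum_(n <oo) (if pickle_inv n is Some i then a i else 0).
Proof.
move=> a0; rewrite nneseries_esumT; last by move=> n; case: pickle_inv.
have bij : set_bij setT (range (@pickle I)) (@pickle I).
  split; first by move=> i _; exists i.
    by move=> i j _ _; exact: (pcan_inj pickleK).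
  by [].
transitivity (\esum_(n in range (@pickle I))
    (if pickle_inv n is Some i then a i else 0)).
  have -> := @reindex_esum R _ _ _ _ _
    (fun n => if pickle_inv n is Some i then a i else 0) bij.
  by apply: eq_esum => i _; rewrite pickleK_inv.
rewrite esum_mkcond; apply: eq_esum => n _; case: ifPn => //.
have := @pickle_invK I n; case: (pickle_inv n) => [i|]/= E;
  rewrite ?notin_setE => H.
  by case: H; exists i.
by [].

Qed.

Lemma integral_esum {d} {T : measurableType d} {I : countType}
    (mu : {measure set T -> \bar R}) (f : I -> T -> \bar R) :
  (forall i, measurable_fun setT (f i)) -> (forall i x, 0 <= f i x) ->
  \int[mu]_x (\esum_(i in setT) f i x) = \esum_(i in setT) \int[mu]_x f i x.
Proof.
move=> mf f0; rewrite esum_countType; last by move=> i; exact: integral_ge0.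
under eq_integral do rewrite esum_countType//.
rewrite integral_nneseries//=.
- apply: eq_eseriesr => n _; case: pickle_inv => [i//|]; exact: integral0.
- by move=> n; case: pickle_inv => // i; exact: measurable_cst.
- by move=> n x _; case: pickle_inv.
Qed.

(* The library version asks for measurable integrands; monotonicity holds
   without it because the integral of a nonnegative function is a supremum over
   the simple functions below it. *)
Lemma ge0_le_integral_nonmeasurable {d} {T : measurableType d}
    (mu : {measure set T -> \bar R}) (f g : T -> \bar R) :
  (forall x, 0 <= f x) -> (forall x, f x <= g x) ->
  \int[mu]_x f x <= \int[mu]_x g x.
Proof.
move=> f0 fg; rewrite !ge0_integralTE//; last first.
  by move=> x; exact: le_trans (fg x).
apply: le_ereal_sup => _ [h/= hf <-]; exists h => //= x.
exact: le_trans (fg x).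
Qed.

Lemma le_esum_term {I : choiceType} (a : I -> \bar R) i : (forall j, 0 <= a j)
  ->
  a i <= \esum_(j in setT) a j.
Proof.
move=> a0; apply: esum_ge; exists [set i]; last by rewrite fsbig_set1.
by split => //; exact: finite_set1.
Qed.

Lemma esumZ {I : choiceType} (c : R) (a : I -> \bar R) : (0 <= c)%R ->
  (forall i, 0 <= a i) ->
  \esum_(i in setT) (c%:E * a i) = c%:E * \esum_(i in setT) a i.
Proof.
move=> c0 a0.
(* One inequality for all scalars is enough: the other one is its instance at [c^-1]. *)
suff H (k : R) (b : I -> \bar R) : (0 <= k)%R -> (forall i, 0 <= b i) ->
    \esum_(i in setT) (k%:E * b i) <= k%:E * \esum_(i in setT) b i.
  apply/eqP; rewrite eq_le H//=.
  have [->|cn0] := eqVneq c 0%R; first by rewrite mul0e esum_ge0// => i _;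
    rewrite mul0e.
  have cgt0 : (0 < c)%R by rewrite lt_neqAle eq_sym cn0.
  rewrite -lee_pdivlMl//; apply: le_trans (H _ _ _ _).
  - apply: le_esum => i _; rewrite muleA -EFinM mulVf// mul1e//.
  - by rewrite invr_ge0.
  - by move=> i; rewrite mule_ge0.
move=> k0 b0; apply: ge_ereal_sup => _ [X [finX _] <-].
rewrite -ge0_mule_fsumr//; apply: lee_wpmul2l => //.
by apply: ereal_sup_ubound; exists X.
Qed.

Lemma esum_exchange {I J : choiceType} (a : I -> J -> \bar R) :
  (forall i j, 0 <= a i j) ->
  \esum_(i in setT) \esum_(j in setT) a i j =
  \esum_(j in setT) \esum_(i in setT) a i j.
Proof.
move=> a0; rewrite !esum_esum//.
rewrite (reindex_esum (setT `*`` (fun=> setT)) (setT `*`` (fun=> setT)) 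
  (fun ij : I * J => (ij.2, ij.1)))//.
split => //.
- by move=> [i j] [i' j'] _ _ [-> ->].
- by move=> [j i] _; exists (i, j).
Qed.

End esum_integral.

(** * Norms on the half-line against norms of sequences *)

Section dyadic_norm.
Local Open Scope ereal_scope.
Context {R : realType}.
Implicit Types (r q : \bar R) (y : int -> \bar R) (h : R -> \bar R).

(** Meant for nonnegative sequences, hence no absolute values. Under [0 < r] the last branch is the
    case [r = +oo]. *)
Definition seqnorm r y : \bar R :=
  match r with
  | r'%:E => (\esum_(k in setT) (y k `^ r')) `^ r'^-1
  | _ => ereal_sup (range y)
  end.

Let mu : {measure set (lebesgueTypeR R) -> \bar R} :=
  @completed_lebesgue_measure R.

Lemma integral_dyadic (c : int -> \bar R) : (forall k, 0 <= c k) ->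
  \int[mu]_x (if (0 < x)%R then c (dlog x) else 0) =
  \esum_(k in setT) (c k * (pow2 k%:~R)%:E).
Proof.
move=> c0.
transitivity (\int[mu]_x \esum_(k in setT) (c k * (\1_(dyadic k) x)%:E)).
  apply: eq_integral => x _; case: ifPn => x0.
    apply/esym; rewrite (esumID [set dlog x])//; last first.
      by move=> k _; rewrite mule_ge0// lee_fin.
    rewrite !setTI esum_set1 ?mule_ge0 ?lee_fin//.
    rewrite indicE mem_set ?mule1; last exact: dyadic_dlog.
    rewrite esum1 ?adde0// => k kx;
      rewrite indicE memNset ?mule0// => /dyadic_inj.
    exact: kx.
  rewrite esum1// => k _; rewrite indicE memNset ?mule0// => /dyadic_gt0.
  exact/negP.
have mI k : measurable_fun setT
    (fun x : lebesgueTypeR R => (\1_(dyadic k) x : R)%:E).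
  by apply/measurable_EFinP; apply: measurable_indic; exact: measurable_dyadic.
rewrite integral_esum.
- apply: eq_esum => k _; rewrite ge0_integralZl//.
    rewrite integral_indic//; last exact: measurable_dyadic.
    by rewrite setIT; congr (_ * _); exact: dyadic_measure.
- by move=> k; apply: emeasurable_funM => //; exact: measurable_cst.
- by move=> k x; rewrite mule_ge0// lee_fin.
Qed.

Lemma ler_poweR (s : R) (x y : \bar R) : (0 <= s)%R -> 0 <= x -> x <= y ->
  x `^ s <= y `^ s.
Proof.
move=> s0 x0 xy; apply: gt0_ler_poweR => //.
  by rewrite in_itv/= x0 leey.
by rewrite in_itv/= leey andbT (le_trans x0).
Qed.

Lemma poweR_VK (s : R) (x : \bar R) : (0 < s)%R -> 0 <= x ->
  (x `^ s) `^ s^-1 = x.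
Proof. by move=> s0 x0; rewrite -poweRrM mulfV ?gt_eqF// poweRe1. Qed.

Lemma pow2V_le (k : int) (x : R) : dyadic k x -> (x^-1 <= pow2 (- k%:~R))%R.
Proof.
move=> kx; rewrite pow2N lef_pV2 ?posrE ?pow2_gt0 ?(dyadic_gt0 kx)//.
by move/dyadicP : kx => /andP[].
Qed.

Lemma pow2V_ge (k : int) (x : R) : dyadic k x -> (pow2 (- k%:~R - 1) <= x^-1)%R.
Proof.
move=> kx; rewrite -opprD pow2N lef_pV2 ?posrE ?pow2_gt0 ?(dyadic_gt0 kx)//.
by move/dyadicP : kx => /andP[_ /ltW]; rewrite rmorphD.
Qed.

(** The norm with exponent [+oo] is an essential supremum only when the whole space has positive
    measure. *)
Lemma mu_setT_gt0 : 0 < mu setT.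
Proof.
apply: lt_le_trans (le_measure mu _ _ (@subsetT _ (dyadic 0))).
- by rewrite [ltRHS]dyadic_measure lte_fin pow2_gt0.
- by rewrite inE; exact: measurable_dyadic.
- by rewrite inE.
Qed.

Lemma normL_le_seqnorm r y h : 0 < r -> (forall k, 0 <= y k) ->
  (forall k t, dyadic k t -> `|h t| <= (t `^ (- fine r^-1))%:E * y k) ->
  normL r `]0%R, +oo[ h <= seqnorm r y.
Proof.
move=> r0 y0 hy; rewrite /normL unlock /seqnorm; case: r r0 hy => [r| |]//.
- rewrite lte_fin => r0 hy; apply: ler_poweR.
  + by rewrite invr_ge0 ltW.
  + by apply: integral_ge0 => x _; exact: poweR_ge0.
  pose c k := (pow2 (- k%:~R))%:E * y k `^ r.
  have c0 k : 0 <= c k by rewrite mule_ge0 ?lee_fin ?pow2_ge0 ?poweR_ge0.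
  rewrite [leRHS](_ : _ = \esum_(k in [set: int]) (c k * (pow2 k%:~R)%:E)).
    rewrite -integral_dyadic//; apply: ge0_le_integral_nonmeasurable => x.
      exact: poweR_ge0.
    rewrite patchE mem_setE in_itv/= andbT; case: ifPn => x0; last first.
      by rewrite abse0 poweR0r// gt_eqF.
    apply: (@le_trans _ _ (((x `^ (- r^-1))%:E * y (dlog x)) `^ r)).
      apply: ler_poweR => //; first exact: ltW.
      have := hy _ _ (dyadic_dlog x0).
      by rewrite inver gt_eqF.
    rewrite poweRM ?lee_fin ?powR_ge0// poweR_EFin -powRrM mulNr mulVf
      ?gt_eqF//.
    rewrite powR_inv1 ?(ltW x0)//; apply: lee_wpmul2r; first exact: poweR_ge0.
    by rewrite lee_fin; exact/pow2V_le/dyadic_dlog.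
  apply: eq_esum => k _; rewrite /c muleAC -EFinM -pow2D addNr pow2_0 mul1e//.
- move=> _ hy; rewrite mu_setT_gt0.
  apply/ess_supP; apply: nearW => x /=.
  rewrite patchE mem_setE in_itv/= andbT; case: ifPn => x0.
    have := hy _ _ (dyadic_dlog x0); rewrite invey/= oppr0 powRr0 mul1e.
    by move=> /le_trans; apply; apply: ereal_sup_ubound; exists (dlog x).
  rewrite (_ : point = 0)// abse0; apply: (le_trans (y0 0%R)).
  by apply: ereal_sup_ubound; exists 0%R.
Qed.

(** Here 1/t >= 2^(-k-1) on the interval; the lost factor 2 becomes 2^(1/r) after the root. *)
Lemma seqnorm_le_normL r y h : 0 < r -> (forall k, 0 <= y k) ->
  (forall k t, dyadic k t -> (t `^ (- fine r^-1))%:E * y k <= `|h t|) ->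
  seqnorm r y <= (pow2 (fine r^-1))%:E * normL r `]0%R, +oo[ h.
Proof.
move=> r0 y0 hy; rewrite /normL unlock /seqnorm; case: r r0 hy => [r| |]//.
- rewrite lte_fin => r0 hy.
  pose c k := (pow2 (- k%:~R - 1))%:E * y k `^ r.
  have c0 k : 0 <= c k by rewrite mule_ge0 ?lee_fin ?pow2_ge0 ?poweR_ge0.
  have -> : \esum_(k in setT) y k `^ r = 2%:E * \esum_(k in [set: int]) (c k *
    (pow2 k%:~R)%:E).
    rewrite -esumZ//; last by move=> i; rewrite mule_ge0 ?lee_fin ?pow2_ge0.
    apply: eq_esum => k _; rewrite /c muleAC -EFinM muleA -EFinM.
    rewrite [X in X%:E * _](_ : _ = 1%R) ?mul1e//.
    by rewrite -pow2D -[X in (X * _)%R]pow2_1 -pow2D -[RHS]pow2_0; congr pow2;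
      ring.
  rewrite inver gt_eqF//= poweRM//; last first.
    by apply: esum_ge0 => k _;  rewrite mule_ge0 ?lee_fin ?pow2_ge0.
  rewrite poweR_EFin.
  apply: lee_wpmul2l; first by rewrite lee_fin powR_ge0.
  apply: ler_poweR.
  + by rewrite invr_ge0 ltW.
  + by apply: esum_ge0 => k _;  rewrite mule_ge0 ?lee_fin ?pow2_ge0.
  rewrite -integral_dyadic//; apply: ge0_le_integral_nonmeasurable => x.
    by case: ifP.
  rewrite patchE mem_setE in_itv/= andbT; case: ifPn => x0; last first.
    exact: poweR_ge0.
  apply: (@le_trans _ _ (((x `^ (- r^-1))%:E * y (dlog x)) `^ r)).
    rewrite poweRM ?lee_fin ?powR_ge0// poweR_EFin -powRrM mulNr mulVf
      ?gt_eqF//.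
    rewrite powR_inv1 ?(ltW x0)//; apply: lee_wpmul2r; first exact: poweR_ge0.
    by rewrite lee_fin; exact/pow2V_ge/dyadic_dlog.
  apply: ler_poweR => //; first exact: ltW.
    by rewrite mule_ge0 ?lee_fin ?powR_ge0.
  have := hy _ _ (dyadic_dlog x0).
  by rewrite inver gt_eqF.
- move=> _ hy; rewrite mu_setT_gt0 invey/= pow2_0 mul1e.
  apply: ge_ereal_sup => _ [k _ <-].
  (* Were [y k] above the essential supremum, the whole k-th dyadic interval, of measure 2^k, would
     lie in a null set. *)
  set S := ess_sup _ _; apply/negP => /negP; rewrite -ltNge => Sk.
  have [N [mN N0 NS]] := ess_sup_ge mu (abse \o h \_ `]0%R, +oo[).
  have : mu (dyadic k) <= mu N.
    apply: le_measure; rewrite ?inE//; first exact: measurable_dyadic.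
    move=> x kx; apply: NS => /=; apply/negP; rewrite -ltNge.
    apply: lt_le_trans Sk _; rewrite patchE mem_setE in_itv/= (dyadic_gt0 kx)/=.
    by have := hy _ _ kx; rewrite invey/= oppr0 powRr0 mul1e.
  by rewrite N0 [leLHS]dyadic_measure leNgt lte_fin pow2_gt0.
Qed.

End dyadic_norm.

(** * Schur test *)

Section schur.
Context {R : realType}.
Implicit Types (k l m : int) (r : \bar R) (y : int -> \bar R).

Definition zdist k l : R := `|k%:~R - l%:~R|.

Lemma zdist_ge0 k l : 0 <= zdist k l. Proof. exact: normr_ge0. Qed.

Lemma zdistC k l : zdist k l = zdist l k. Proof. exact: distrC. Qed.

Lemma zdistxx k : zdist k k = 0. Proof. by rewrite /zdist subrr normr0. Qed.

Lemma zdist_triangle k l m : zdist k m <= zdist k l + zdist l m.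
Proof. exact: ler_distD. Qed.

Lemma zdistE k l : zdist k l = `|k - l|%N%:R.
Proof. by rewrite /zdist -rmorphB/= -intr_norm pmulrn abszE. Qed.

Local Open Scope ereal_scope.

Lemma esum_geometric (d : R) : (0 < d)%R -> exists2 D : R, (0 < D)%R &
  forall m, \esum_(k in setT) (pow2 (- d * zdist k m))%:E <= D%:E.
Proof.
move=> d0; set q := pow2 (- d).
have q0 : (0 < q)%R by exact: pow2_gt0.
have q1 : (q < 1)%R by rewrite -pow2_0 ltr_pow2 oppr_lt0.
have q1' : (`|q| < 1)%R by rewrite ger0_norm// ltW.
have geo : \esum_(n in [set: nat]) (q ^+ n)%:E <= (1 / (1 - q))%:E.
  rewrite -nneseries_esumT; last by move=> n; rewrite lee_fin exprn_ge0// ltW.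
  apply: lime_le.
    by apply: is_cvg_nneseries => n _ _; rewrite lee_fin exprn_ge0// ltW.
  apply: nearW => n; rewrite sumEFin lee_fin.
  apply: le_trans (geometric_le_lim n _ q0 q1') => //.
  rewrite /series/=; apply: ler_sum => i _; by rewrite /geometric/= mul1r.
have q1D : (0 < 1 / (1 - q))%R by rewrite divr_gt0// subr_gt0.
exists (1 / (1 - q) + 1 / (1 - q))%R; first exact: addr_gt0.
move=> m; rewrite (esumID [set k | m <= k]%R); last first.
  by move=> k _; rewrite lee_fin pow2_ge0.
rewrite EFinD; apply: leeD; rewrite setTI.
- apply: le_trans geo.
  rewrite (@reindex_esum R _ _ setT _ (fun n : nat => m + n%:Z)%R).
    apply: le_esum => n _; rewrite lee_fin zdistE addrC addKr absz_nat.
    by rewrite -pow2_powR powR_mulrn// pow2_ge0.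
  split.
  + by move=> n _ /=; rewrite lerDl.
  + by move=> a b _ _ /addrI[].
  + move=> k /= mk; exists `|k - m|%N => //.
    by rewrite gez0_abs; lia.
- apply: le_trans geo.
  (* Indices below [m] start at [m - 1], so the exponent is [n + 1]; the extra factor [q < 1] is
     dropped. *)
  rewrite (@reindex_esum R _ _ setT _ (fun n : nat => m - 1 - n%:Z)%R).
    apply: le_esum => n _; rewrite lee_fin zdistE.
    rewrite (_ : m - 1 - n%:Z - m = - n.+1%:Z)%R; last by rewrite -addn1 PoszD;
      ring.
    rewrite abszN absz_nat -pow2_powR powR_mulrn// ?pow2_ge0// -/q.
    by rewrite exprS ger_pMl ?exprn_gt0// ltW.
  split.
  + by move=> n _ /=; apply/negP; rewrite -ltNge; lia.
  + by move=> a b _ _ ab; lia.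
  + move=> k /= /negP; rewrite -ltNge => mk; exists (absz (m - 1 - k)%R) => //.
    by rewrite gez0_abs; lia.
Qed.

Lemma seqnorm_ge0 r y : (forall k, 0 <= y k) -> 0 <= seqnorm r y.
Proof.
move=> y0; rewrite /seqnorm; case: r => [r||]; first exact: poweR_ge0.
- by apply: le_trans (y0 0%R) _; apply: ereal_sup_ubound; exists 0%R.
- by apply: le_trans (y0 0%R) _; apply: ereal_sup_ubound; exists 0%R.
Qed.

Lemma seqnorm_ge_term r y k : 0 < r -> (forall k, 0 <= y k) -> y k <= seqnorm r
  y.
Proof.
case: r => [r| |//]; last by move=> _ y0; apply: ereal_sup_ubound; exists k.
rewrite lte_fin => r0 y0; rewrite /= -[leLHS](poweR_VK r0 (y0 k)).
apply: ler_poweR; rewrite ?invr_ge0 ?(ltW r0)// ?poweR_ge0//.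
by apply: (@le_esum_term _ _ (fun k => y k `^ r)) => j; exact: poweR_ge0.
Qed.

(** Only the lower half of a quasi-isometry: it keeps the points [s j] from clustering, which is all
    that summation over [j] requires. *)
Definition quasi_expanding (c N : R) (s : int -> int) :=
  forall j j', (c * zdist j j' - N <= zdist (s j) (s j'))%R.

(** Since [l] need not be a value of [s], distances are compared with those to the value [s j0]
    nearest to [l]: then |s j - s j0| <= 2 |l - s j|, so the sum is dominated by a geometric one
    centred at [j0], of rate d c / 2. *)
Lemma esum_quasi_expanding (d c N : R) : (0 < d)%R -> (0 < c)%R ->
  exists2 D : R, (0 < D)%R & forall s l, quasi_expanding c N s ->
   \esum_(j in setT) (pow2 (- d * zdist l (s j)))%:E <= D%:E.
Proof.
move=> d0 c0.
have [|D D0 HD] := @esum_geometric (d * c / 2); first by rewrite !mulr_gt0.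
exists (pow2 (d * N / 2) * D)%R; first by rewrite mulr_gt0// pow2_gt0.
move=> s l sE.
have [j0 Hj0] : exists j0, forall j, (zdist l (s j0) <= zdist l (s j))%R.
  have ex : exists n, `[< exists j, `|l - s j|%N = n >].
    by exists `|l - s 0%R|%N; apply/asboolP; exists 0%R.
  case: (ex_minnP ex) => n /asboolP[j0 j0n] nmin.
  exists j0 => j; rewrite !zdistE ler_nat j0n; apply: nmin.
  by apply/asboolP; exists j.
rewrite EFinM; apply: le_trans (lee_wpmul2l _ (HD j0)); last first.
  by rewrite lee_fin pow2_ge0.
rewrite -esumZ ?pow2_ge0//; last by move=> i; rewrite lee_fin pow2_ge0.
apply: le_esum => j _; rewrite -EFinM lee_fin -pow2D ler_pow2.
have := sE j j0; have := zdist_triangle (s j) l (s j0); have := Hj0 j.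
rewrite (zdistC (s j) l); set a := zdist l _; set b := zdist l _;
  set e := zdist j j0.
set f := zdist (s j) _ => h1 h2 h3.
have : (d * (c * e - N) <= d * (2 * b))%R by rewrite ler_pM2l//; lra.
lra.
Qed.

Lemma poweR_real_ge0 (x : \bar R) : 0 <= x -> x = +oo \/ exists2 a, (0 <= a)%R
  & x = a%:E.
Proof. by case: x => [a|//|//]; [right; exists a | left]. Qed.

(* The hypothesis on [x j] says x_j <= C sup_l 2^(-d|l - s j|) y_l, with the
   supremum replaced by its real upper bounds [A]. *)
Lemma seqnorm_schur r (d c N : R) : 0 < r -> (0 < d)%R -> (0 < c)%R ->
  exists2 D : R, (0 < D)%R & forall (s : int -> int) (C : R) x y,
   (0 < C)%R -> quasi_expanding c N s ->
   (forall k, 0 <= x k) -> (forall k, 0 <= y k) ->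
   (forall j A, (0 < A)%R ->
     (forall l, (pow2 (- d * zdist l (s j)))%:E * y l <= A%:E) ->
     x j <= (C * A)%:E) ->
   seqnorm r x <= (D * C)%:E * seqnorm r y.
Proof.
(* The hypothesis is only asked for [A > 0]; letting [A] decrease to 0 covers vanishing bounds. *)
have gt0_ge0 (s : int -> int) (C : R) x y : (0 < C)%R ->
    (forall j A, (0 < A)%R ->
      (forall l, (pow2 (- d * zdist l (s j)))%:E * y l <= A%:E) ->
      x j <= (C * A)%:E) ->
    forall j A, (0 <= A)%R ->
      (forall l, (pow2 (- d * zdist l (s j)))%:E * y l <= A%:E) ->
      x j <= (C * A)%:E.
  move=> C0 xy j A A0 H; apply/lee_addgt0Pr => e e0.
  have eC : (0 < e / C)%R by exact: divr_gt0.
  rewrite -EFinD (_ : C * A + e = C * (A + e / C))%R; last first.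
    by field; rewrite gt_eqF.
  apply: xy => [|l]; first exact: ltr_wpDl.
  by apply: le_trans (H l) _; rewrite lee_fin lerDl ltW.
case: r => [r| |//] r0 d0 c0; last first.
  exists 1%R => // s C x y C0 sE x0 y0 /(gt0_ge0 _ _ _ _ C0) xy; rewrite mul1r.
  have [->|[a a0 aE]] := poweR_real_ge0 (seqnorm_ge0 +oo y0).
    by rewrite gt0_muley ?lte_fin// leey.
  rewrite aE; apply: ge_ereal_sup => _ [j _ <-]; apply: xy => // l.
  apply: (@le_trans _ _ (1 * y l)).
    by apply: lee_wpmul2r => //;
      rewrite lee_fin -pow2_0 ler_pow2 mulNr oppr_le0 mulr_ge0 ?zdist_ge0// ltW.
  by rewrite mul1e -aE; apply: seqnorm_ge_term.
rewrite lte_fin in r0.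
have [|D D0 HD] := @esum_quasi_expanding (d * r) c N _ c0;
  first exact: mulr_gt0.
exists (D `^ r^-1)%R; first exact: powR_gt0.
move=> s C x y C0 sE x0 y0 /(gt0_ge0 _ _ _ _ C0) xy.
pose M l j := pow2 (- (d * r) * zdist l (s j)).
have M0 l j : (0 <= M l j)%R by exact: pow2_ge0.
have yr0 l : 0 <= y l `^ r by exact: poweR_ge0.
have My0 l j : 0 <= (M l j)%:E * y l `^ r by rewrite mule_ge0 ?lee_fin.
have ME l j : (M l j)%:E * y l `^ r = ((pow2 (- d * zdist l (s j)))%:E * y l)
  `^ r.
  rewrite poweRM ?lee_fin ?pow2_ge0// poweR_EFin pow2_powR /M.
  by congr ((pow2 _)%:E * _); ring.
have key j : x j `^ r <= (C `^ r)%:E * \esum_(l in setT) ((M l j)%:E * y l `^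
  r).
  set S := \esum_(l in setT) _.
  have S0 : 0 <= S by exact: esum_ge0.
  have [SE|[a a0 SE]] := poweR_real_ge0 S0.
    by rewrite SE gt0_muley ?lte_fin ?powR_gt0// leey.
  rewrite SE.
  (* The bound [A] is the l^r norm of the weighted sequence, which exceeds each of its terms. No
     triangle inequality is involved, so r < 1 is allowed. *)
  apply: (@le_trans _ _ ((C * a `^ r^-1)%:E `^ r)).
    apply: ler_poweR => //; first exact: ltW.
    apply: xy => [|l]; first exact: powR_ge0.
    rewrite -[leRHS]poweR_EFin -SE.
    have z0 : 0 <= (pow2 (- d * zdist l (s j)))%:E * y l by rewrite mule_ge0
      ?lee_fin ?pow2_ge0.
    rewrite -[leLHS](poweR_VK r0 z0) -ME; apply: ler_poweR => //.
      by rewrite invr_ge0 ltW.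
    exact: (@le_esum_term _ _ (fun l => (M l j)%:E * y l `^ r)).
  rewrite poweR_EFin -EFinM lee_fin powRM ?powR_ge0 ?(ltW C0)//.
  by rewrite -powRrM mulVf ?gt_eqF// powRr1.
rewrite /seqnorm.
set Y := \esum_(k in [set: int]) y k `^ r.
have Y0 : 0 <= Y by exact: esum_ge0.
have -> : (D `^ r^-1 * C)%:E * Y `^ r^-1 = ((C `^ r)%:E * (D%:E * Y)) `^ r^-1.
  have E : ((C `^ r * D) `^ r^-1 = D `^ r^-1 * C)%R.
    have r1 : (r * r^-1 = 1)%R by rewrite mulfV// gt_eqF.
    rewrite (powRM _ (powR_ge0 _ _) (ltW D0)).
    by rewrite -(powRrM C r) r1 powRr1 ?(ltW C0)// mulrC.
  have CD0 : 0 <= (C `^ r * D)%:E by rewrite lee_fin mulr_ge0 ?powR_ge0 ?(ltW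
    D0).
  by rewrite muleA -EFinM (poweRM _ CD0 Y0) poweR_EFin E.
apply: ler_poweR.
- by rewrite invr_ge0 ltW.
- by apply: esum_ge0 => k _; exact: poweR_ge0.
apply: (@le_trans _ _ (\esum_(j in setT) ((C `^ r)%:E * \esum_(l in setT) ((M l
  j)%:E * y l `^ r)))).
  by apply: le_esum => j _; exact: key.
rewrite esumZ ?powR_ge0//; last by move=> j; exact: esum_ge0.
apply: lee_wpmul2l; first by rewrite lee_fin powR_ge0.
(* With the sums exchanged, the weights are summed over [j] for fixed [l], where quasi-expansion
   bounds them by [D]. *)
rewrite esum_exchange// -esumZ ?(ltW D0)//; apply: le_esum => l _.
under eq_esum do rewrite muleC.
have [yE|[a a0 yE]] := poweR_real_ge0 (yr0 l).
  by rewrite yE gt0_muley ?lte_fin// leey.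
rewrite yE esumZ//; last by move=> j; rewrite lee_fin.
by rewrite muleC; apply: lee_wpmul2r => //; exact: HD.
Qed.

Lemma seqnorm_single r (a : R) k : 0 < r -> (0 <= a)%R ->
  seqnorm r (fun l => if l == k then a%:E else 0) <= a%:E.
Proof.
case: r => [r| |//]; last first.
  by move=> _ a0; apply: ge_ereal_sup => _ [l _ <-]; case: ifP;
    rewrite ?lee_fin.
rewrite lte_fin => r0 a0; rewrite /= (esumID [set k]); last first.
  by move=> l _; exact: poweR_ge0.
rewrite !setTI esum_set1 ?poweR_ge0// eqxx esum1 ?adde0 ?poweR_VK ?lee_fin//.
by move=> l /= /eqP/negbTE ->; rewrite poweR0r// gt_eqF.
Qed.

End schur.

(** * Slow variation *)

Section slowly_varying_sequences.
Context {R : realType}.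
Implicit Types (k l m : int) (r : \bar R) (b : R -> R) (g : int -> R).

Definition sv_seq g : Prop := (forall k, 0 < g k) /\
  forall e : R, 0 < e -> exists2 C : R, 0 < C &
    forall k m, g k <= C * pow2 (e * zdist k m) * g m.

Lemma zdist_id : quasi_expanding (1 : R) 0 id.
Proof. by move=> j j'; rewrite mul1r subr0. Qed.

Lemma powR_dyadic_le k l (s t e : R) : 0 < e -> dyadic k s -> dyadic l t ->
  s <= t -> t `^ e <= pow2 e * pow2 (e * zdist k l) * s `^ e.
Proof.
move=> e0 ks lt st; have s0 := dyadic_gt0 ks.
have -> : pow2 e * pow2 (e * zdist k l) = pow2 (1 + zdist k l) `^ e.
  by rewrite pow2_powR -pow2D; congr pow2; ring.
rewrite -powRM ?pow2_ge0 ?(ltW s0)//.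
apply: ge0_ler_powR; rewrite ?nnegrE ?(ltW e0) ?mulr_ge0 ?pow2_ge0 ?(ltW s0)//.
  exact: le_trans (ltW s0) st.
move/dyadicP : ks => /andP[ks _]; move/dyadicP : lt => /andP[_ lt].
apply: (le_trans (ltW lt)).
apply: (@le_trans _ _ (pow2 (1 + zdist k l) * pow2 k%:~R)); last first.
  by rewrite ler_pM2l// pow2_gt0.
rewrite -pow2D ler_pow2 rmorphD/=.
have := ler_norm (l%:~R - k%:~R : R); rewrite -[`|_|]/(zdist l k) zdistC; lra.
Qed.

(** A Potter bound. For s <= t it comes from the almost increasing t^e b(t), for t <= s from the
    almost decreasing t^(-e) b(t). Passing to the monotone function and back squares the constant;
    [pow2 e] pays for the positions inside the dyadic intervals. *)
Lemma slowly_varying_dyadic b : slowly_varying b -> forall e : R, 0 < e ->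
  exists2 C : R, 0 < C & forall k l s t, dyadic k s -> dyadic l t ->
    b s <= C * pow2 (e * zdist k l) * b t.
Proof.
move=> [b0 _ binc bdec] e e0.
have [g ginc [C C0 gC]] := binc _ e0.
have [h hdec [D D0 hD]] := bdec _ e0.
exists ((C ^+ 2 + D ^+ 2) * pow2 e).
  by rewrite mulr_gt0 ?pow2_gt0// addr_gt0// exprn_gt0.
move=> k l s t ks lt; have s0 := dyadic_gt0 ks; have t0 := dyadic_gt0 lt.
have S0 : 0 < s `^ e by exact: powR_gt0.
have T0 : 0 < t `^ e by exact: powR_gt0.
have bs := b0 _ s0; have bt := b0 _ t0.
have CC : 0 < C ^+ 2 by exact: exprn_gt0.
have DD : 0 < D ^+ 2 by exact: exprn_gt0.
have [st|/ltW ts] := leP s t.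
- have [h1 _] := gC _ s0; have [_ h2] := gC _ t0.
  have h3 : g s <= g t by apply: ginc => //; rewrite in_itv/= ?s0 ?t0.
  have h4 : s `^ e * b s <= C ^+ 2 * (t `^ e * b t).
    apply: (le_trans h1); rewrite expr2 -mulrA ler_pM2l//.
    exact: le_trans h2.
  have := powR_dyadic_le e0 ks lt st.
  set E := pow2 e * _ => h5.
  rewrite -(ler_pM2l S0); apply: (le_trans h4).
  rewrite [leRHS](_ : _ = (C ^+ 2 + D ^+ 2) * (E * s `^ e * b t));
    last by rewrite /E; ring.
  apply: ler_pM; [exact: ltW|by rewrite mulr_ge0// ltW|by rewrite lerDl ltW|].
  by rewrite ler_pM2r.
- have [h1 _] := hD _ s0; have [_ h2] := hD _ t0.
  have h3 : h s <= h t by apply: hdec => //; rewrite in_itv/= ?s0 ?t0.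
  have h4 : s `^ (- e) * b s <= D ^+ 2 * (t `^ (- e) * b t).
    apply: (le_trans h1); rewrite expr2 -mulrA ler_pM2l//.
    exact: le_trans h2.
  have := powR_dyadic_le e0 lt ks ts; rewrite zdistC.
  set E := pow2 e * _ => h5.
  have E0 : 0 < E by rewrite mulr_gt0 ?pow2_gt0.
  move: h4; rewrite !powRN ler_pdivrMl// => h4; apply: (le_trans h4).
  rewrite [leRHS](_ : _ = (C ^+ 2 + D ^+ 2) * (E * b t)); last by rewrite /E;
    ring.
  rewrite mulrCA; apply: ler_pM; [exact: ltW| |by rewrite lerDr ltW|].
    by rewrite mulr_ge0 ?mulr_ge0 ?invr_ge0// ltW.
  by rewrite mulrA ler_pM2r// ler_pdivrMr.
Qed.

Lemma sv_seq_slowly_varying b : slowly_varying b ->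
  sv_seq (fun k => b (pow2 k%:~R)).
Proof.
move=> bSV; split; first by case: (bSV) => b0 _ _ _ k; exact/b0/pow2_gt0.
move=> e e0; have [C C0 HC] := slowly_varying_dyadic bSV e0.
by exists C => // k m; apply: HC; exact: dyadic_pow2.
Qed.

End slowly_varying_sequences.

(** * Discretization and slow variation of the tail norms *)

Section tail.
Context {R : realType}.
Implicit Types (k l m : int) (r : \bar R) (b : R -> R) (g : int -> R).
Local Open Scope ereal_scope.

Lemma seqnorm_schur_id r (d : R) : 0 < r -> (0 < d)%R ->
  exists2 D : R, (0 < D)%R & forall (C : R) x y,
   (0 < C)%R -> (forall k, 0 <= x k) -> (forall k, 0 <= y k) ->
   (forall j A, (0 < A)%R ->
     (forall l, (pow2 (- d * zdist l j))%:E * y l <= A%:E) -> x j <= (C *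
       A)%:E) ->
   seqnorm r x <= (D * C)%:E * seqnorm r y.
Proof.
move=> r0 d0; have [D D0 HD] := seqnorm_schur 0 r0 d0 ltr01.
by exists D => // C x y C0 x0 y0; apply: HD => //; exact: zdist_id.
Qed.

(** Brings tail and inner norms to the half-line, where the discretization is stated. *)
Lemma normL_restrict r (A : set R) (h : R -> \bar R) : A `<=` `]0%R, +oo[ ->
  normL r A h = normL r `]0%R, +oo[ (h \_ A).
Proof.
move=> A0; rewrite /normL; congr ('N[_]_r[_]); apply/funext => x.
rewrite !patchE; case: ifPn => [xA|xA]; last by case: ifP.
by rewrite ifT// inE; apply: A0; rewrite -inE.
Qed.

Definition tail_seqnorm r b k : \bar R :=
  seqnorm r (fun l => (if (k <= l)%R then b (pow2 l%:~R) else 0%R)%:E).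

Lemma tail_seqnorm_term_ge0 b k l : slowly_varying b ->
  0 <= (if (k <= l)%R then b (pow2 l%:~R) else 0%R)%:E.
Proof.
by case=> b0 _ _ _; rewrite lee_fin; case: ifP => // _; exact/ltW/b0/pow2_gt0.
Qed.

Lemma dyadic_le k l (s t : R) : dyadic k s -> dyadic l t -> (s <= t)%R ->
  (k <= l)%R.
Proof.
move=> /dyadicP/andP[ks _] /dyadicP/andP[_ lt] st.
rewrite -ltzD1 -(ltr_int R) -ltr_pow2.
exact: le_lt_trans (le_trans ks st) lt.
Qed.

(** Monotonicity and homogeneity together, read off the Schur test at the single index [l = j]; the
    price is the constant [D]. *)
Lemma seqnorm_le_scale r : 0 < r -> exists2 D : R, (0 < D)%R &
  forall (C : R) x y, (0 < C)%R -> (forall k, 0 <= x k) ->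
   (forall k, 0 <= y k) -> (forall k, x k <= C%:E * y k) ->
   seqnorm r x <= (D * C)%:E * seqnorm r y.
Proof.
move=> r0; have [D D0 HD] := seqnorm_schur_id r0 ltr01.
exists D => // C x y C0 x0 y0 xy; apply: HD => // j A A0 /(_ j).
rewrite zdistxx mulr0 pow2_0 mul1e => jA; apply: le_trans (xy j) _.
by rewrite EFinM; apply: lee_wpmul2l => //; rewrite lee_fin ltW.
Qed.

Lemma tail_norm_le r b : 0 < r -> slowly_varying b ->
  exists2 C : R, (0 < C)%R & forall k t, dyadic k t ->
    tail_norm r b t <= C%:E * tail_seqnorm r b k.
Proof.
move=> r0 bSV; have [C C0 HC] := slowly_varying_dyadic bSV ltr01.
have [D D0 HD] := seqnorm_le_scale r0.
exists (D * C)%R => [|k t kt]; first exact: mulr_gt0.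
have t0 := dyadic_gt0 kt.
rewrite /tail_norm normL_restrict; last first.
  by move=> x /=; rewrite !in_itv/= !andbT; exact: lt_trans.
have Bge0 l := tail_seqnorm_term_ge0 k l bSV.
pose x l := C%:E * (if (k <= l)%R then b (pow2 l%:~R) else 0%R)%:E.
have x0 l : 0 <= x l by rewrite mule_ge0// lee_fin ltW.
apply: (le_trans _ (HD C x _ C0 x0 Bge0 (fun=> lexx _))).
apply: normL_le_seqnorm => // l s ls; rewrite patchE; case: ifPn => [|_];
  last first.
  by rewrite abse0; apply: mule_ge0; [rewrite lee_fin powR_ge0|exact: x0].
rewrite inE/= in_itv/= andbT => ts.
have s0 := dyadic_gt0 ls.
rewrite /x (dyadic_le kt ls (ltW ts)) -!EFinM lee_fin ger0_norm; last first.
  by rewrite mulr_ge0 ?powR_ge0// ltW//; case: bSV => b0 _ _ _; exact: b0.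
apply: ler_wpM2l; first exact: powR_ge0.
by have := HC _ _ _ _ ls (dyadic_pow2 l); rewrite zdistxx mulr0 pow2_0 mulr1.
Qed.

(** Terms with j >= m already belong to the tail at [m]. A term with k <= j < m is compared with
    b(2^m), the first term of that tail. Half of [e] goes to the variation of [b], half to the decay
    in the Schur test. *)
Lemma tail_seqnorm_sv r b : 0 < r -> slowly_varying b -> forall e : R, (0 <
  e)%R ->
  exists2 C : R, (0 < C)%R & forall k m,
    tail_seqnorm r b k <= (C * pow2 (e * zdist k m))%:E * tail_seqnorm r b m.
Proof.
move=> r0 bSV e e0.
have e20' : (0 < e / 2)%R by exact: divr_gt0.
have [C C0 HC] := (sv_seq_slowly_varying bSV).2 _ e20'.
have [D D0 HD] := seqnorm_schur_id r0 e20'.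
have Bge0 := tail_seqnorm_term_ge0 _ _ bSV.
have b0 x : (0 < x)%R -> (0 < b x)%R by case: bSV => + _ _ _; exact.
exists (D * (C + 1))%R => [|k m]; first by rewrite mulr_gt0// addr_gt0.
rewrite -mulrA; apply: HD => //; first by rewrite mulr_gt0 ?pow2_gt0// addr_gt0.
move=> j A /ltW A0 H.
have E1 : (1 <= pow2 (e * zdist k m))%R by rewrite -pow2_0 ler_pow2 mulr_ge0
  ?zdist_ge0 ?(ltW e0).
case: ifPn => [kj|_];
  last by rewrite lee_fin !mulr_ge0 ?pow2_ge0// addr_ge0// ltW.
rewrite lee_fin; have [mj|jm] := leP m j.
  have := H j; rewrite mj zdistxx mulr0 pow2_0 mul1e lee_fin => /le_trans;
    apply.
  by apply: ler_peMl => //; apply: mulr_ege1 => //; rewrite lerDr ltW.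
have := H m; rewrite lexx -EFinM lee_fin => Hm.
apply: (le_trans (HC j m)).
pose u := pow2 (- (e / 2) * zdist m j); have u0 : (0 < u)%R by exact: pow2_gt0.
apply: (@le_trans _ _ (C * (pow2 (e * zdist k m) * (u * b (pow2 m%:~R))))%R).
  rewrite -mulrA ler_pM2l// [leRHS]mulrA; apply: ler_wpM2r.
    exact/ltW/b0/pow2_gt0.
  rewrite /u -pow2D ler_pow2.
  rewrite -subr_ge0 (_ : _ - _ = e * (zdist k m - zdist j m))%R; last first.
    by rewrite [zdist m j]zdistC; field.
  apply: mulr_ge0; first exact: ltW.
  rewrite subr_ge0 /zdist !ler0_norm ?subr_le0 ?ler_int ?(ltW jm)//.
    by rewrite lerN2 lerD2r ler_int.
  exact: le_trans kj (ltW jm).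
rewrite mulrA; apply: ler_pM.
- by rewrite mulr_ge0 ?pow2_ge0// ltW.
- by rewrite mulr_ge0 ?(ltW u0)//; exact/ltW/b0/pow2_gt0.
- by rewrite ler_wpM2r ?pow2_ge0// lerDl.
- exact: Hm.
Qed.

(** For t in the k-th interval, (t, oo) is only sure to contain the dyadic intervals from [k + 1]
    on. The missing term at [k] is recovered by slow variation of the tail between [k] and
    [k + 1]. *)
Lemma le_tail_norm r b : 0 < r -> slowly_varying b ->
  exists2 C : R, (0 < C)%R & forall k t, dyadic k t ->
    tail_seqnorm r b k <= C%:E * tail_norm r b t.
Proof.
move=> r0 bSV; have [C C0 HC] := slowly_varying_dyadic bSV ltr01.
have [D D0 HD] := seqnorm_le_scale r0.
have [E E0 HE] := tail_seqnorm_sv r0 bSV ltr01.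
exists (E * pow2 1 * (D * C) * pow2 (fine r^-1))%R => [|k t kt].
  by rewrite !mulr_gt0 ?pow2_gt0.
have t0 := dyadic_gt0 kt.
have b0 x : (0 < x)%R -> (0 < b x)%R by case: bSV => + _ _ _; exact.
apply: le_trans (HE k (k + 1)%R) _.
have -> : zdist k (k + 1) = 1%R :> R.
  by rewrite /zdist rmorphD/= opprD addNKr normrN normr1.
rewrite mulr1 !EFinM -!muleA.
do 2 (apply: lee_wpmul2l; first by rewrite lee_fin ?pow2_ge0// ltW).
have Bge0 l := tail_seqnorm_term_ge0 (k + 1) l bSV.
pose x l := (C^-1)%:E * (if (k + 1 <= l)%R then b (pow2 l%:~R) else 0%R)%:E.
have x0 l : 0 <= x l by rewrite mule_ge0// lee_fin invr_ge0 ltW.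
apply: (@le_trans _ _ ((D * C)%:E * seqnorm r x)).
  by apply: HD => // l; rewrite /x -!EFinM lee_fin mulVKf ?gt_eqF.
rewrite EFinM -muleA.
do 2 (apply: lee_wpmul2l; first by rewrite lee_fin ltW).
rewrite /tail_norm normL_restrict; last first.
  by move=> y /=; rewrite !in_itv/= !andbT; exact: lt_trans.
apply: seqnorm_le_normL => // l s ls; rewrite patchE /x.
case: ifPn => [kl|_]; last by rewrite !mule0 ?abse_ge0.
have s0 := dyadic_gt0 ls.
rewrite ifT; last first.
  rewrite inE/= in_itv/= andbT.
  move/dyadicP : kt => /andP[_ /lt_le_trans]; apply.
  move/dyadicP : ls => /andP[+ _]; apply: le_trans.
  by rewrite ler_pow2 ler_int.
rewrite -!EFinM lee_fin ger0_norm; last first.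
  by rewrite mulr_ge0 ?powR_ge0// ltW// b0.
apply: ler_wpM2l; first exact: powR_ge0.
rewrite mulrC ler_pdivrMr// mulrC.
by have := HC _ _ _ _ (dyadic_pow2 l) ls; rewrite zdistxx mulr0 pow2_0 mulr1.
Qed.

Lemma fin_le_mule (x y : \bar R) (C : R) : 0 <= x -> x <= C%:E * y ->
  y \is a fin_num -> x \is a fin_num.
Proof.
move=> x0 xy yfin; rewrite ge0_fin_numE//; apply: le_lt_trans xy _.
by rewrite ltey_eq fin_numM.
Qed.

(** Finiteness at t = 1, which lies in the interval of index 0, spreads to all scales by slow
    variation; positivity holds because the tail dominates its first term b(2^k). *)
Lemma tail_sequence r b : 0 < r -> slowly_varying b -> tail_norm r b 1 < +oo ->
  exists g : int -> R, [/\ sv_seq g,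
    (forall k, tail_seqnorm r b k = (g k)%:E) &
    exists2 C : R, (0 < C)%R & forall k t, dyadic k t ->
     (fine (tail_norm r b t) <= C * g k)%R /\
     (g k <= C * fine (tail_norm r b t))%R].
Proof.
move=> r0 bSV b1; exists (fun k => fine (tail_seqnorm r b k)).
have [C C0 HC] := tail_norm_le r0 bSV.
have [D D0 HD] := le_tail_norm r0 bSV.
have b0 x : (0 < x)%R -> (0 < b x)%R by case: bSV => + _ _ _; exact.
have T0 k : 0 <= tail_seqnorm r b k.
  by apply: seqnorm_ge0 => l; exact: tail_seqnorm_term_ge0.
have N0 t : 0 <= tail_norm r b t by exact: Lnorm_ge0.
have N1 : tail_norm r b 1 \is a fin_num by rewrite ge0_fin_numE.
have d1 : @dyadic R 0%R 1%R by rewrite -[X in dyadic _ X](@pow2_0 R);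
  exact: (dyadic_pow2 0%R).
have Tfin0 : tail_seqnorm r b 0%R \is a fin_num.
  exact: fin_le_mule (T0 _) (HD _ _ d1) N1.
have Tfin k : tail_seqnorm r b k \is a fin_num.
  have [E E0 HE] := tail_seqnorm_sv r0 bSV ltr01.
  exact: fin_le_mule (T0 _) (HE _ _) Tfin0.
have TE k : tail_seqnorm r b k = (fine (tail_seqnorm r b k))%:E by rewrite
  fineK.
have bT k : (b (pow2 k%:~R) <= fine (tail_seqnorm r b k))%R.
  rewrite -lee_fin -TE.
  have := @seqnorm_ge_term R r (fun l => (if (k <= l)%R then b (pow2 l%:~R)
    else 0%R)%:E) k r0.
  by rewrite lexx; apply=> l; exact: tail_seqnorm_term_ge0.
split => //.
- split; first by move=> k; apply: lt_le_trans (bT k); exact/b0/pow2_gt0.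
  move=> e e0; have [E E0 HE] := tail_seqnorm_sv r0 bSV e0; exists E => // k m.
  by rewrite -lee_fin EFinM -!TE.
- exists (C + D)%R; first exact: addr_gt0.
  move=> k t kt; have h1 := HC _ _ kt; have h2 := HD _ _ kt.
  have Nfin := fin_le_mule (N0 t) h1 (Tfin k).
  move: h1 h2; rewrite -(fineK Nfin) TE -!EFinM !lee_fin => h1 h2.
  have g0 : (0 <= fine (tail_seqnorm r b k))%R by exact: fine_ge0.
  have n0 : (0 <= fine (tail_norm r b t))%R by exact: fine_ge0.
  by split; [apply: le_trans h1 _|apply: le_trans h2 _];
    apply: ler_wpM2r => //; lra.
Qed.

End tail.

(** * Rearrangements *)

Section rearrangement.
Context {d : measure_display} {T : measurableType d} {R : realType}.
Variable mu : {measure set T -> \bar R}.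
Implicit Types (f g h : T -> R) (l s t : R).
Local Open Scope ereal_scope.

Lemma rearrangement_ge0 f t : 0 <= rearrangement mu f t.
Proof. by apply: le_ereal_inf_tmp => _ [l [l0 _] <-]; rewrite lee_fin. Qed.

Lemma rearrangement_le_level f l t : (0 <= l)%R ->
  mu [set x | (l < `|f x|)%R] <= t%:E -> rearrangement mu f t <= l%:E.
Proof. by move=> l0 lt; apply: ereal_inf_lbound; exists l. Qed.

Lemma le_rearrangement f s t : (s <= t)%R ->
  rearrangement mu f t <= rearrangement mu f s.
Proof.
move=> st; apply: le_ereal_inf => _ [l [l0 lt] <-]; exists l => //; split => //.
by apply: le_trans lt _; rewrite lee_fin.
Qed.

Lemma measurable_level f l : measurable_fun setT f ->
  measurable [set x | (l < `|f x|)%R].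
Proof.
move=> mf; rewrite -[X in measurable X]setTI.
have : measurable_fun setT (fun x => `|f x|%R) by exact: measurableT_comp.
by move=> /(_ measurableT _ (measurable_itv `]l, +oo[));
  congr (measurable (_ `&` _));
  apply/seteqP; split => x /=; rewrite in_itv/= andbT.
Qed.

(** The infimum defining f^*(t) is attained when finite: the level set at [l] is the increasing
    union of those at l + 1/(n+1), and the measure is continuous from below. *)
Lemma measure_level_rearrangement f l t : measurable_fun setT f ->
  rearrangement mu f t = l%:E -> mu [set x | (l < `|f x|)%R] <= t%:E.
Proof.
move=> mf fl.
pose F n := [set x | (l + n.+1%:R^-1 < `|f x|)%R].
have mF n : measurable (F n) by exact: measurable_level.
have FE : [set x | (l < `|f x|)%R] = \bigcup_n F n.
  apply/seteqP; split => x /=; last first.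
    by case=> n _; apply: lt_trans; rewrite ltrDl invr_gt0.
  by move=> /ltr_add_invr[n ln]; exists n.
have Fnd : nondecreasing_seq F.
  move=> m n mn; apply/subsetPset => x /=; apply: le_lt_trans.
  by rewrite lerD2l lef_pV2 ?posrE// ler_nat.
have cF : mu (F n) @[n --> \oo] --> mu (\bigcup_n F n).
  by apply: nondecreasing_cvg_mu => //; exact: bigcup_measurable.
rewrite FE -(cvg_lim _ cF)//; apply: lime_le; first by apply/cvg_ex; eexists;
  exact: cF.
apply: nearW => n.
have : rearrangement mu f t < (l + n.+1%:R^-1)%:E by rewrite fl lte_fin ltrDl
  invr_gt0.
move=> /ereal_inf_lt[_ [l' [l'0 lt] <-]]; rewrite lte_fin => l'l.
apply: le_trans lt; apply: le_measure; rewrite ?inE//;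
  first exact: measurable_level.
by move=> x /=; exact: lt_trans.
Qed.

Lemma rearrangement_mono f g t : measurable_fun setT f -> measurable_fun setT g
  ->
  (forall x, `|g x| <= `|f x|)%R -> rearrangement mu g t <= rearrangement mu f
    t.
Proof.
move=> mf mg gf; apply: le_ereal_inf => _ [l [l0 lt] <-]; exists l => //;
  split => //.
apply: le_trans lt; apply: le_measure; rewrite ?inE//;
  [exact: measurable_level..|].
by move=> x /= /lt_le_trans; apply.
Qed.

(** With a = g^*(s) and b = h^*(t) finite, {|f| > a + b} is contained, up to a null set, in {|g| >
    a} union {|h| > b}. As both infima are attained, no epsilon is lost. *)
Lemma rearrangementD f g h s t : measurable_fun setT f ->
  measurable_fun setT g -> measurable_fun setT h ->
  {ae mu, forall x, f x = (g x + h x)%R} ->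
  rearrangement mu f (s + t) <= rearrangement mu g s + rearrangement mu h t.
Proof.
move=> mf mg mh [N [mN N0 fgh]].
have [gE|[a a0 gE]] := poweR_real_ge0 (rearrangement_ge0 g s).
  by rewrite gE addye ?leey// gt_eqF// (lt_le_trans _ (rearrangement_ge0 _ _)).
have [hE|[b b0 hE]] := poweR_real_ge0 (rearrangement_ge0 h t).
  by rewrite hE gE addey ?leey.
rewrite gE hE; apply: rearrangement_le_level; first exact: addr_ge0.
have la := measure_level_rearrangement mg gE.
have lb := measure_level_rearrangement mh hE.
pose A := [set x | (a < `|g x|)%R]; pose B := [set x | (b < `|h x|)%R].
have mA : measurable A by exact: measurable_level.
have mB : measurable B by exact: measurable_level.
apply: (@le_trans _ _ (mu ((A `|` B) `|` N))).
  apply: le_measure; rewrite ?inE//; first exact: measurable_level.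
    by apply: measurableU => //; exact: measurableU.
  move=> x /= abx; have [Nx|Nx] := pselect (N x); first by right.
  left; have E : f x = (g x + h x)%R.
    by apply: contra_notP Nx => ?; exact: fgh.
  have := ler_normD (g x) (h x); rewrite -E => gh.
  rewrite /A /B/=; have [ag|ga] := ltP a `|g x|%R; first by left.
  right; lra.
rewrite measureU0//; last exact: measurableU.
apply: le_trans (measureU2 _ _ _) _ => //.
by rewrite EFinD; exact: leeD.
Qed.

Definition clip (l x : R) : R := Num.max (- l)%R (Num.min l x).

Lemma clipP l x : (0 <= l)%R ->
  [/\ (`|clip l x| <= `|x|)%R, (`|clip l x| <= l)%R,
      (`|x - clip l x| <= `|x|)%R & (`|x| <= l)%R -> clip l x = x].
Proof.
move=> l0; rewrite /clip; have [lx|xl] := ltP l x.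
  have x0 : (0 < x)%R by exact: le_lt_trans lx.
  rewrite max_r; last by lra.
  rewrite (gtr0_norm x0) (ger0_norm l0) ger0_norm; last by lra.
  by split; [lra..|move=> xl; lra].
have [lx|xl'] := leP (- l)%R x.
  rewrite subrr normr0; split => //; rewrite ler_norml lx; lra.
have x0 : (x < 0)%R by lra.
rewrite (ltr0_norm x0) normrN (ger0_norm l0) ltr0_norm; last by lra.
by split; [lra..|move=> lx; lra].
Qed.

Lemma measurable_clip f l : measurable_fun setT f ->
  measurable_fun setT (fun x => clip l (f x)).
Proof.
move=> mf; apply: measurable_maxr; first exact: measurable_cst.
by apply: measurable_minr => //; exact: measurable_cst.
Qed.

Lemma rearrangement_clip f l t : (0 <= l)%R -> (0 <= t)%R ->
  rearrangement mu (fun x => clip l (f x)) t <= l%:E.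
Proof.
move=> l0 t0; apply: rearrangement_le_level => //.
rewrite [X in mu X](_ : _ = set0) ?measure0 ?lee_fin//.
apply/seteqP; split => // x /=; apply/negP; rewrite -leNgt.
by have [] := clipP (f x) l0.
Qed.

Lemma rearrangement_subclip f l t : (0 <= l)%R -> measurable_fun setT f ->
  mu [set x | (l < `|f x|)%R] <= t%:E ->
  rearrangement mu (fun x => f x - clip l (f x))%R t <= 0.
Proof.
move=> l0 mf lt; apply: rearrangement_le_level => //.
apply: le_trans lt; apply: le_measure; rewrite ?inE.
- apply: measurable_level; apply: measurable_funB => //; exact: measurable_clip.
- exact: measurable_level.
move=> x /=; apply: contraPP => /negP; rewrite -leNgt => fl.
by have [_ _ _ ->//] := clipP (f x) l0; rewrite subrr normr0 ltxx.
Qed.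

End rearrangement.

(** * Small Lorentz norms *)

Section small_Lorentz_estimates.
Context {d : measure_display} {T : measurableType d} {R : realType}.
Variable mu : {measure set T -> \bar R}.
Implicit Types (f : T -> R) (k l m : int).

Lemma dyadic_powR k (t e : R) : 0 <= e -> dyadic k t ->
  pow2 (e * k%:~R) <= t `^ e /\ t `^ e <= pow2 e * pow2 (e * k%:~R).
Proof.
move=> e0 kt; have t0 := dyadic_gt0 kt.
move/dyadicP : kt => /andP[kt tk].
rewrite -pow2D -[X in pow2 (X + _)]mulr1 -mulrDr.
rewrite ![e * _]mulrC -!pow2_powR; split; apply: ge0_ler_powR;
  rewrite ?nnegrE ?pow2_ge0 ?(ltW t0)//.
by rewrite addrC; move/ltW : tk; rewrite rmorphD.
Qed.

Local Open Scope ereal_scope.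

Definition dyadic_rearr f k := rearrangement mu f (pow2 k%:~R).

Lemma dyadic_rearr_ge0 f k : 0 <= dyadic_rearr f k.
Proof. exact: rearrangement_ge0. Qed.

Lemma dyadic_rearr_le f k l : (k <= l)%R -> dyadic_rearr f l <= dyadic_rearr f
  k.
Proof. by move=> kl; apply: le_rearrangement; rewrite ler_pow2 ler_int. Qed.

Lemma rearrangement_dyadic f k t : dyadic k t ->
  rearrangement mu f t <= dyadic_rearr f k /\
  dyadic_rearr f (k + 1) <= rearrangement mu f t.
Proof.
by move/dyadicP => /andP[kt /ltW tk]; split; exact: le_rearrangement.
Qed.

Lemma powR_split (t a b : R) : (0 < t)%R -> (t `^ (a - b) = t `^ (- b) * t `^
  a)%R.
Proof. by move=> t0; rewrite addrC powRD // (gt_eqF t0) implybT. Qed.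

Lemma normL_ge0 q (A : set R) (h : R -> \bar R) : 0 <= normL q A h.
Proof. exact: Lnorm_ge0. Qed.

Definition inner_norm p q f (t : R) := normL q `]0%R, t[
   (fun u => (u `^ (p^-1 - fine q^-1))%:E * rearrangement mu f u).

(** Only the dyadic interval of index [k - 1] is kept: it lies inside (0, t) once k <= m, and f^* is
    at least f^*(2^k) on it. The real [v] stands in for a possibly infinite f^*(2^k); the constant
    pays for the shift and for the discretization. *)
Lemma inner_lower (p : R) (q : \bar R) : (0 < p)%R -> 0 < q ->
  exists2 C : R, (0 < C)%R & forall f k m t v, (0 <= v)%R ->
    v%:E <= dyadic_rearr f k -> (k <= m)%R -> dyadic m t ->
    (pow2 (p^-1 * k%:~R) * v)%:E <= C%:E * inner_norm p q f t.
Proof.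
move=> p0 q0; exists (pow2 p^-1 * pow2 (fine q^-1))%R;
  first by rewrite mulr_gt0 ?pow2_gt0.
move=> f k m t v v0 vf km mt.
pose y l : \bar R := if l == (k - 1)%R then (pow2 (p^-1 * (k - 1)%:~R) * v)%:E
  else 0.
have y0 l : 0 <= y l.
  by rewrite /y; case: ifP => // _; rewrite lee_fin mulr_ge0// pow2_ge0.
have t0 := dyadic_gt0 mt.
have : seqnorm q y <= (pow2 (fine q^-1))%:E * inner_norm p q f t.
  rewrite /inner_norm normL_restrict; last first.
    by move=> u /=; rewrite !in_itv/= andbT => /andP[].
  apply: seqnorm_le_normL => // l u lu; rewrite /y.
  case: ifPn => [/eqP lk|_]; last by rewrite mule0 abse_ge0.
  have u0 := dyadic_gt0 lu.
  have ut : (u < t)%R.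
    move/dyadicP : lu => /andP[_ /lt_le_trans]; apply.
    move/dyadicP : mt => /andP[+ _]; apply: le_trans.
    by rewrite ler_pow2 ler_int lk subrK.
  rewrite patchE ifT; last by rewrite inE/= in_itv/= u0.
  rewrite gee0_abs; last by rewrite mule_ge0 ?lee_fin ?powR_ge0
    ?rearrangement_ge0.
  rewrite powR_split// [in leRHS]EFinM -muleA; apply: lee_wpmul2l.
    by rewrite lee_fin powR_ge0.
  rewrite EFinM; apply: lee_pmul; rewrite ?lee_fin ?pow2_ge0//.
    rewrite -lk; apply: (dyadic_powR _ lu).1; rewrite invr_ge0; exact: ltW.
  apply: le_trans vf _; have := (rearrangement_dyadic f lu).2.
  by rewrite lk subrK.
move=> H; have := seqnorm_ge_term (k - 1)%R q0 y0; rewrite {1}/y eqxx => h1.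
rewrite [in leRHS]EFinM -muleA.
apply: (@le_trans _ _ ((pow2 p^-1)%:E * (pow2 (p^-1 * (k - 1)%:~R) * v)%:E)).
  rewrite -EFinM lee_fin mulrA -pow2D ler_wpM2r// ler_pow2 rmorphB/=.
  by rewrite mulrBr mulr1 addrCA subrr addr0.
by apply: lee_wpmul2l; [rewrite lee_fin pow2_ge0|exact: le_trans H].
Qed.

(** For t >= 2^k the inner norm is bounded below independently of t, so it factors out and leaves
    the tail of [b] from 2^k on. *)
Lemma small_Lorentz_norm_lower (p : R) (q r : \bar R) (b : R -> R)
    (g : int -> R) : (0 < p)%R -> 0 < q -> 0 < r -> slowly_varying b ->
  (forall k, tail_seqnorm r b k = (g k)%:E) -> (forall k, 0 < g k)%R ->
  exists2 C : R, (0 < C)%R & forall f k,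
    (pow2 (p^-1 * k%:~R) * g k)%:E * dyadic_rearr f k <=
      C%:E * small_Lorentz_norm mu p q r b f.
Proof.
move=> p0 q0 r0 bSV gE g0.
have [C C0 HC] := inner_lower p0 q0.
have [B B0 HB] := slowly_varying_dyadic bSV ltr01.
have [D D0 HD] := seqnorm_le_scale r0.
have b0 x : (0 < x)%R -> (0 < b x)%R by case: bSV => + _ _ _; exact.
exists (D * (B * C) * pow2 (fine r^-1))%R; first by rewrite !mulr_gt0 ?pow2_gt0.
move=> f k; set N := small_Lorentz_norm _ _ _ _ _ _.
have N0 : 0 <= N by exact: normL_ge0.
set K := (D * _ * _)%R; have K0 : (0 < K)%R by rewrite !mulr_gt0 ?pow2_gt0.
have eg0 : (0 < pow2 (p^-1 * k%:~R) * g k)%R by rewrite mulr_gt0 ?pow2_gt0.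
suff key v : (0 < v)%R -> v%:E <= dyadic_rearr f k ->
    (pow2 (p^-1 * k%:~R) * g k * v)%:E <= K%:E * N.
  have [fE|[v v0 fE]] := poweR_real_ge0 (dyadic_rearr_ge0 f k); last first.
    rewrite fE -EFinM; move: v0; rewrite le_eqVlt => /predU1P[<-|v0].
      by rewrite mulr0 mule_ge0// lee_fin ltW.
    by apply: key => //; rewrite fE.
  rewrite fE gt0_muley ?lte_fin//.
  have [->|[n n0 nE]] := poweR_real_ge0 N0;
    first by rewrite gt0_muley ?lte_fin// leey.
  (* If f^*(2^k) is infinite, every [v] is admissible; this one would give K n + 1 <= K n. *)
  exfalso; have v0 : (0 < (K * n + 1) / (pow2 (p^-1 * k%:~R) * g k))%R.
    by rewrite divr_gt0// ltr_wpDl// mulr_ge0// ltW.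
  have := key _ v0; rewrite fE leey nE => /(_ isT).
  by rewrite -EFinM lee_fin mulrC divfK ?gt_eqF// gerDl ler10.
move=> v0 vf.
set w := (pow2 (p^-1 * k%:~R) * v)%R.
have w0 : (0 < w)%R by rewrite mulr_gt0// pow2_gt0.
(* [C] comes from the inner norm and [B] from replacing b(t) by b(2^m) inside the m-th interval. *)
pose y m := (w / (B * C))%:E * (if (k <= m)%R then b (pow2 m%:~R) else 0%R)%:E.
have Bge0 l := tail_seqnorm_term_ge0 k l bSV.
have wBC : (0 < w / (B * C))%R by apply: divr_gt0 => //; exact: mulr_gt0.
have y0 m : 0 <= y m by apply: mule_ge0 (Bge0 m); rewrite lee_fin ltW.
have H : seqnorm r y <= (pow2 (fine r^-1))%:E * N.
  apply: seqnorm_le_normL => // m t mt; rewrite /y.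
  have t0 := dyadic_gt0 mt.
  case: ifPn => [km|_]; last by rewrite !mule0 abse_ge0.
  rewrite gee0_abs; last first.
    by apply: mule_ge0; [rewrite lee_fin mulr_ge0 ?powR_ge0// ltW// b0|exact:
      normL_ge0].
  rewrite [in leRHS]EFinM -muleA; apply: lee_wpmul2l.
    by rewrite lee_fin powR_ge0.
  have := HC f k m t v (ltW v0) vf km mt; rewrite -/w => h1.
  apply: (@le_trans _ _ ((b t)%:E * (C^-1%:E * w%:E))).
    rewrite -!EFinM lee_fin.
    have := HB _ _ _ _ (dyadic_pow2 m) mt;
      rewrite zdistxx mulr0 pow2_0 mulr1 => h2.
    rewrite (_ : _ / _ * _ = C^-1 * w * (B^-1 * b (pow2 m%:~R)))%R; last first.
      by field; rewrite !gt_eqF.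
    rewrite [leRHS]mulrC ler_wpM2l//; first by rewrite mulr_ge0 ?invr_ge0// ltW.
    by rewrite ler_pdivrMl.
  apply: lee_wpmul2l; first by rewrite lee_fin ltW// b0.
  by rewrite lee_pdivrMl.
have /(HD (B * C / w)%R) : (0 < B * C / w)%R by rewrite divr_gt0// mulr_gt0.
move=> /(_ _ y Bge0 y0) H2.
have {}H2 := H2 _; rewrite -/(tail_seqnorm r b k) gE in H2.
have : (g k)%:E <= (D * (B * C / w))%:E * seqnorm r y.
  apply: H2 => l; rewrite /y -!EFinM lee_fin; set a := (if _ then _ else _).
  rewrite [leRHS](_ : _ = a)//; by field; rewrite !gt_eqF.
move=> h3.
have {h3} h3 : (g k)%:E <= (D * (B * C / w))%:E * ((pow2 (fine r^-1))%:E * N).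
  apply: le_trans h3 _; apply: lee_wpmul2l => //.
  rewrite lee_fin; apply: mulr_ge0; apply: ltW => //.
  by apply: divr_gt0 => //; exact: mulr_gt0.
rewrite (_ : _ * _ * v = w * g k)%R; last by rewrite /w; ring.
rewrite EFinM; apply: (@le_trans _ _ (w%:E * ((D * (B * C / w))%:E * ((pow2
  (fine r^-1))%:E * N)))).
  by apply: lee_wpmul2l => //; rewrite lee_fin ltW.
rewrite !muleA -!EFinM /K.
rewrite [X in X%:E * _ <= _](_ : _ = D * (B * C) * pow2 (fine r^-1))%R//.
by field; rewrite gt_eqF.
Qed.

End small_Lorentz_estimates.

(** * Upper bounds for functions concentrated at one scale *)

Section small_Lorentz_upper.
Context {d : measure_display} {T : measurableType d} {R : realType}.
Variable mu : {measure set T -> \bar R}.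
Implicit Types (f : T -> R) (k l m : int).
Local Open Scope ereal_scope.

Lemma zdist_le k l : (k <= l)%R -> zdist k l = (l%:~R - k%:~R)%R :> R.
Proof.
by move=> kl; rewrite /zdist distrC ger0_norm// subr_ge0 ler_int.
Qed.

(** Cut at [m], the profile 2^(-e|l-k|) peaks at min(k, m) and decays geometrically from there, so
    its l^q norm is comparable to its peak. The Schur test is applied to the sequence carrying only
    that peak. *)
Lemma inner_norm_upper (p : R) (q : \bar R) (e : R) :
  (0 < p)%R -> 0 < q -> (0 < e)%R ->
  exists2 C : R, (0 < C)%R & forall f k B, (0 < B)%R ->
    (forall l, (pow2 (p^-1 * l%:~R))%:E * dyadic_rearr mu f l <=
               (B * pow2 (- e * zdist l k))%:E) ->
    forall m t, dyadic m t ->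
    inner_norm mu p q f t <= (C * (B * pow2 (- e * zdist (Num.min k m) k)))%:E.
Proof.
move=> p0 q0 e0; have [D D0 HD] := seqnorm_schur_id q0 e0.
exists (D * pow2 p^-1)%R; first by rewrite mulr_gt0 ?pow2_gt0.
move=> f k B B0 H m t mt.
set n := Num.min k m; set E := (B * pow2 (- e * zdist n k))%R.
have E0 : (0 < E)%R by rewrite mulr_gt0 ?pow2_gt0.
pose z l : \bar R := (if (l <= m)%R then pow2 p^-1 * (B * pow2 (- e * zdist l
  k)) else 0)%R%:E.
have z0 l : 0 <= z l.
  by rewrite /z lee_fin; case: ifP => // _; rewrite !mulr_ge0 ?pow2_ge0// ltW.
pose y l : \bar R := if l == n then E%:E else 0.
have y0 l : 0 <= y l by rewrite /y; case: ifP => // _; rewrite lee_fin ltW.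
apply: (@le_trans _ _ (seqnorm q z)).
  rewrite /inner_norm normL_restrict; last first.
    by move=> u /=; rewrite !in_itv/= andbT => /andP[].
  apply: normL_le_seqnorm => // l u lu.
  have u0 := dyadic_gt0 lu.
  rewrite patchE; case: ifPn => [|_]; last first.
    by rewrite abse0; apply: mule_ge0 (z0 l); rewrite lee_fin powR_ge0.
  rewrite inE/= in_itv/= u0/= => ut.
  rewrite gee0_abs; last first.
    by apply: mule_ge0; [rewrite lee_fin powR_ge0|exact: rearrangement_ge0].
  rewrite powR_split// EFinM -muleA; apply: lee_wpmul2l.
    by rewrite lee_fin powR_ge0.
  rewrite /z (dyadic_le lu mt (ltW ut)) [leRHS]EFinM.
  apply: (@le_trans _ _ ((pow2 p^-1)%:E * ((pow2 (p^-1 * l%:~R))%:E *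
    dyadic_rearr mu f l))).
    rewrite muleA -EFinM; apply: lee_pmul.
    - by rewrite lee_fin powR_ge0.
    - exact: rearrangement_ge0.
    - by rewrite lee_fin (dyadic_powR _ lu).2// invr_ge0 ltW.
    - exact: (rearrangement_dyadic mu f lu).1.
  by apply: lee_wpmul2l (H l); rewrite lee_fin pow2_ge0.
rewrite EFinM; apply: (@le_trans _ _ ((D * pow2 p^-1)%:E * seqnorm q y));
  last first.
  apply: lee_wpmul2l; first by rewrite lee_fin mulr_ge0 ?pow2_ge0// ltW.
  by apply: seqnorm_single => //; exact: ltW.
apply: HD => //; first exact: pow2_gt0.
move=> j A A0 /(_ n); rewrite /y eqxx -EFinM lee_fin => nA.
rewrite /z lee_fin; case: ifPn => [jm|_]; last first.
  by rewrite mulr_ge0 ?pow2_ge0// ltW.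
rewrite ler_pM2l ?pow2_gt0//; apply: le_trans nA.
rewrite /E mulrCA ler_pM2l// -pow2D ler_pow2 -mulrDr !mulNr lerN2 ler_pM2l//.
rewrite /n; have [km|mk] := leP k m; first by rewrite zdistxx addr0 zdistC.
rewrite (zdistC _ j) !zdist_le ?(ltW mk)//; first lra.
exact: le_trans (ltW mk).
Qed.

(** Scales m >= k see the full inner norm and produce the tail [g k]. For m < k the decay
    2^(-e(k-m)) beats the variation of [b], allowed at rate e/2, and the remaining 2^(-(e/2)(k-m))
    b(2^k) is controlled by one term of the tail. *)
Lemma small_Lorentz_norm_upper (p : R) (q r : \bar R) (b : R -> R)
    (g : int -> R) (e : R) :
  (0 < p)%R -> 0 < q -> 0 < r -> slowly_varying b ->
  (forall k, tail_seqnorm r b k = (g k)%:E) -> (0 < e)%R ->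
  exists2 C : R, (0 < C)%R & forall f k B, (0 < B)%R ->
    (forall l, (pow2 (p^-1 * l%:~R))%:E * dyadic_rearr mu f l <=
               (B * pow2 (- e * zdist l k))%:E) ->
    small_Lorentz_norm mu p q r b f <= (C * (B * g k))%:E.
Proof.
move=> p0 q0 r0 bSV gE e0.
have e20' : (0 < e / 2)%R by exact: divr_gt0.
have [C C0 HC] := inner_norm_upper p0 q0 e0.
have [D D0 HD] := seqnorm_schur_id r0 e20'.
have [F F0 HF] := slowly_varying_dyadic bSV e20'.
have b0 x : (0 < x)%R -> (0 < b x)%R by case: bSV => + _ _ _; exact.
exists (D * (F * C * (1 + F)))%R.
  by rewrite !mulr_gt0// ltr_wpDl.
move=> f k B B0 H.
have Tge0 l := tail_seqnorm_term_ge0 k l bSV.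
pose E m := (B * pow2 (- e * zdist (Num.min k m) k))%R.
have E0 m : (0 < E m)%R by rewrite mulr_gt0 ?pow2_gt0.
pose z m := (F * b (pow2 m%:~R) * (C * E m))%R%:E.
have z0 m : 0 <= z m.
  rewrite lee_fin ltW//; apply: mulr_gt0; apply: mulr_gt0 => //.
  exact/b0/pow2_gt0.
apply: (@le_trans _ _ (seqnorm r z)).
  apply: normL_le_seqnorm => // m t mt; have t0 := dyadic_gt0 mt.
  rewrite gee0_abs; last first.
    by apply: mule_ge0; [rewrite lee_fin mulr_ge0 ?powR_ge0// ltW// b0|exact:
      normL_ge0].
  rewrite [in leLHS]EFinM -muleA; apply: lee_wpmul2l;
    first by rewrite lee_fin powR_ge0.
  rewrite /z EFinM; apply: lee_pmul.
  - by rewrite lee_fin ltW// b0.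
  - exact: normL_ge0.
  - by rewrite lee_fin; have := HF _ _ _ _ mt (dyadic_pow2 m);
      rewrite zdistxx mulr0 pow2_0 mulr1.
  - exact: HC H _ _ mt.
have -> : (D * (F * C * (1 + F)) * (B * g k))%:E =
    (D * (F * C * (1 + F) * B))%:E * tail_seqnorm r b k.
  by rewrite gE -EFinM; congr EFin; ring.
have FC0 : (0 < F * C * B)%R by rewrite !mulr_gt0.
apply: HD => //.
  by rewrite !mulr_gt0// addr_gt0.
move=> m A A0 HA; rewrite /z lee_fin.
have [km|mk] := leP k m.
  have := HA m; rewrite km zdistxx mulr0 pow2_0 mul1e lee_fin => bA.
  rewrite /E min_l// zdistxx mulr0 pow2_0 mulr1.
  rewrite (_ : _ * _ = F * C * B * b (pow2 m%:~R))%R; last by ring.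
  rewrite (_ : _ * A = F * C * B * ((1 + F) * A))%R; last by ring.
  rewrite ler_pM2l//; apply: le_trans bA _.
  by rewrite mulrDl mul1r lerDl mulr_ge0// ltW.
have := HA k; rewrite lexx -EFinM lee_fin => bA.
have := HF _ _ _ _ (dyadic_pow2 m) (dyadic_pow2 k) => bmk.
rewrite /E min_r ?(ltW mk)//.
rewrite (_ : _ * _ = F * C * B * (pow2 (- e * zdist m k) * b (pow2 m%:~R)))%R;
  last by ring.
rewrite (_ : _ * A = F * C * B * ((1 + F) * A))%R; last by ring.
rewrite ler_pM2l//; apply: (@le_trans _ _ (F * A)%R); last first.
  by rewrite mulrDl mul1r lerDr ltW.
apply: (@le_trans _ _ (pow2 (- e * zdist m k) * (F * pow2 (e / 2 * zdist m k) *
  b (pow2 k%:~R)))%R).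
  by rewrite ler_pM2l ?pow2_gt0.
rewrite (_ : _ * _ = F * (pow2 (- e * zdist m k) * pow2 (e / 2 * zdist m k) * b
  (pow2 k%:~R)))%R; last by ring.
rewrite ler_pM2l// -pow2D.
rewrite (_ : _ + _ = - (e / 2) * zdist k m)%R//.
by rewrite (zdistC k); field.
Qed.

End small_Lorentz_upper.

(** * Slowly perturbed linear sequences *)

Section log_scale.
Context {R : realType}.
Implicit Types (k l m j : int) (u v : int -> R).

Definition slow u : Prop := forall e : R, 0 < e -> exists N : R,
  forall k m, u k <= u m + e * zdist k m + N.

Lemma sv_seq_slow (g : int -> R) : sv_seq g ->
  exists2 u, slow u & forall k, g k = pow2 (u k).
Proof.
move=> [g0 gC]; exists (fun k => ln (g k) / ln 2); last first.
  by move=> k; rewrite pow2_log.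
move=> e e0; have [C C0 HC] := gC e e0.
exists (ln C / ln 2) => k m; rewrite -ler_pow2 !pow2D !pow2_log//.
apply: le_trans (HC k m) _.
by rewrite le_eqVlt; apply/orP; left; apply/eqP; ring.
Qed.

Definition quasi_increasing (a b N : R) u := forall k m, m <= k ->
  a * zdist k m - N <= u k - u m <= b * zdist k m + N.

(** Each slow part is used at rate a/4, so the slope stays between a/2 and 3a/2. *)
Lemma quasi_increasing_slow (a : R) u v : 0 < a -> slow u -> slow v ->
  exists N, quasi_increasing (a / 2) (2 * a) N
              (fun k => a * k%:~R + u k - v k).
Proof.
move=> a0 su sv.
have a4 : 0 < a / 4 by exact: divr_gt0.
have [M HM] := su _ a4; have [N HN] := sv _ a4; exists (M + N) => k m mk.
have := HM k m; have := HM m k; have := HN k m; have := HN m k.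
rewrite (zdistC m k) (zdistC k m) (zdist_le mk).
have : 0 <= k%:~R - m%:~R :> R by rewrite subr_ge0 ler_int.
move: (k%:~R : R) (m%:~R : R) => x y xy h1 h2 h3 h4.
have := mulr_ge0 (ltW a0) xy; rewrite !mulrBr.
by move=> h5; apply/andP; split; lra.
Qed.

(** Although [u] need not be monotone, one step raises it by at most b + N. Hence the index just
    before it first exceeds [j], counted from a point far enough to the left, has a value within b +
    N of [j]. *)
Lemma quasi_inverse (a b N : R) u : 0 < a -> 0 < b ->
  quasi_increasing a b N u ->
  exists s : int -> int,
    (forall j, u (s j) <= j%:~R <= u (s j) + (b + N)) /\
    quasi_expanding b^-1 ((2 * (b + N) + N) / b) s.
Proof.
move=> a0 b0 uE.
have ex j : exists k, u k <= j%:~R <= u k + (b + N).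
  (* Chosen so that a M outweighs both |u 0 - j| and the error N: then u(-M) < j < u(M). *)
  pose x := (`|u 0 - j%:~R| + `|N| + 1) / a.
  have x0 : 0 <= x by apply: divr_ge0 (ltW a0); rewrite !addr_ge0.
  pose M := Num.bound x; have xM : x < M%:R by exact: archi_boundP.
  have aM : `|u 0 - j%:~R| + `|N| + 1 <= a * M%:R.
    by move: xM; rewrite ltr_pdivrMr// mulrC => /ltW.
  have dM : zdist 0 (- M%:Z) = M%:R :> R.
    by rewrite /zdist sub0r rmorphN/= opprK ger0_norm.
  have dM' : zdist M%:Z 0 = M%:R :> R by rewrite /zdist subr0 ger0_norm.
  have /andP[h1 _] : a * zdist 0 (- M%:Z) - N <= u 0 - u (- M%:Z) <= b * zdist
    0 (- M%:Z) + N.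
    by apply: uE; rewrite oppr_le0.
  have /andP[h2 _] : a * zdist M%:Z 0 - N <= u M%:Z - u 0 <= b * zdist M%:Z 0 +
    N.
    by apply: uE.
  rewrite dM in h1; rewrite dM' in h2.
  have := ler_norm (u 0 - j%:~R); have := lerNnormlW (lexx `|u 0 - j%:~R|).
  have := ler_norm N => hN hu1 hu2.
  have exP : exists n : nat, j%:~R < u (n%:Z - M%:Z).
    exists (M + M)%N; rewrite PoszD addrK; lra.
  case: (ex_minnP exP) => -[|n] Pn nmin.
    by exfalso; move: Pn; rewrite sub0r; lra.
  pose k := n%:Z - M%:Z; exists k.
  have nM : n.+1%:Z - M%:Z = k + 1 by rewrite -addn1 PoszD /k addrAC.
  have kj : u k <= j%:~R.
    by rewrite leNgt; apply/negP => /nmin; rewrite ltnn.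
  have kk : k <= k + 1 by rewrite lerDl.
  have /andP[_] := uE _ _ kk.
  rewrite (_ : zdist _ _ = 1); last first.
    by rewrite /zdist rmorphD/= addrAC subrr add0r normr1.
  by move: Pn; rewrite nM kj/=; lra.
have [s sE] := choice ex; exists s; split => // j j'.
wlog : j j' / s j' <= s j.
  move=> H; have [/H//|/ltW/H] := leP (s j') (s j).
  by rewrite (zdistC j') (zdistC (s j')).
move=> ss; have := uE _ _ ss; have := sE j; have := sE j'.
move=> /andP[h1 h2] /andP[h3 h4] /andP[h5 h6].
rewrite -(ler_pM2l b0) mulrBr !mulrA mulfV ?gt_eqF// mul1r.
rewrite [b * _ / b]mulrAC mulfV ?gt_eqF// mul1r.
rewrite lerBlDr /zdist ler_norml -[`|(s j)%:~R - _|]/(zdist (s j) (s j')).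
have ad : 0 <= a * zdist (s j) (s j') by rewrite mulr_ge0 ?zdist_ge0// ltW.
have bd : 0 <= b * zdist (s j) (s j') by rewrite mulr_ge0 ?zdist_ge0// ltW.
by apply/andP; split; lra.
Qed.

Lemma quasi_expanding_floor (a b N : R) u (J : int -> int) :
  quasi_increasing a b N u ->
  (forall k, (J k)%:~R <= u k <= (J k)%:~R + 1) ->
  quasi_expanding a (N + 1) J.
Proof.
move=> uE JE k m.
wlog : k m / m <= k.
  move=> H; have [/H//|/ltW/H] := leP m k.
  by rewrite (zdistC m) (zdistC (J m)).
move=> mk; have /andP[h1 _] := uE _ _ mk.
have /andP[h2 h3] := JE k; have /andP[h4 h5] := JE m.
have := ler_norm ((J k)%:~R - (J m)%:~R : R); rewrite -/(zdist (J k) (J m));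
  lra.
Qed.

End log_scale.

(** * Real interpolation *)

Section interpolation.
Context {d : measure_display} {T : measurableType d} {R : realType}.
Variable mu : {measure set T -> \bar R}.
Implicit Types (f : T -> R) (k l m j : int).
Local Open Scope ereal_scope.

(* [u] is the base-2 logarithm of the slowly varying part of the fundamental
   function of [X], and [s] is the exponent of its power part. *)
Definition dominated_below (X : qspace R T) (s : R) (u : int -> R) :=
  exists2 C : R, (0 < C)%R & forall f k,
    (pow2 (s * k%:~R + u k))%:E * dyadic_rearr mu f k <= C%:E * qnorm X f.

Definition dominated_above (X : qspace R T) (s : R) (u : int -> R) :=
  forall e : R, (0 < e)%R -> exists2 C : R, (0 < C)%R & forall f k B, (0 < B)%R
    ->
    (forall l, (pow2 (s * l%:~R))%:E * dyadic_rearr mu f l <=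
               (B * pow2 (- e * zdist l k))%:E) ->
    qnorm X f <= (C * (B * pow2 (u k)))%:E.

Section Kfun_monotone.
Context (X0 X1 : qspace R T).
Hypothesis X0_ge0 : forall f, 0 <= qnorm X0 f.
Hypothesis X1_ge0 : forall f, 0 <= qnorm X1 f.

Lemma Kfun_ge0 u f : (0 <= u)%R -> 0 <= Kfun mu X0 X1 u f.
Proof.
move=> u0; apply: le_ereal_inf_tmp => _ [g _ <-].
by rewrite adde_ge0// mule_ge0// lee_fin.
Qed.

(** Used with [c = 1] as monotonicity of K and with [c = 2] as its doubling property. *)
Lemma Kfun_le (u v c : R) f : (0 <= u)%R -> (1 <= c)%R -> (v <= c * u)%R ->
  Kfun mu X0 X1 v f <= c%:E * Kfun mu X0 X1 u f.
Proof.
move=> u0 c1 vu; have c0 : (0 < c)%R by exact: lt_le_trans c1.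
rewrite -lee_pdivrMl//; apply: le_ereal_inf_tmp => _ [g gD <-].
rewrite lee_pdivrMl//;
  apply: (@le_trans _ _ (qnorm X0 g.1 + v%:E * qnorm X1 g.2)).
  by apply: ereal_inf_lbound; exists g.
rewrite ge0_muleDr ?mule_ge0 ?lee_fin// muleA -EFinM; apply: leeD.
  by rewrite -[leLHS]mul1e; apply: lee_wpmul2r => //; rewrite lee_fin.
by apply: lee_wpmul2r => //; rewrite lee_fin.
Qed.

Definition dyadic_K (theta : R) f j : \bar R :=
  (pow2 (- theta * j%:~R))%:E * Kfun mu X0 X1 (pow2 j%:~R) f.

Lemma dyadic_K_ge0 theta f j : 0 <= dyadic_K theta f j.
Proof. by rewrite mule_ge0 ?lee_fin ?pow2_ge0// Kfun_ge0// pow2_ge0. Qed.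

Lemma powRN_dyadic (theta : R) j t : (0 < theta)%R -> dyadic j t ->
  (pow2 (- theta) * pow2 (- theta * j%:~R) <= t `^ (- theta))%R /\
  (t `^ (- theta) <= pow2 (- theta * j%:~R))%R.
Proof.
move=> th0 jt; have [h1 h2] := dyadic_powR (ltW th0) jt.
have t0 : (0 < t `^ theta)%R by rewrite powR_gt0// (dyadic_gt0 jt).
rewrite powRN mulNr !pow2N -invfM; split; rewrite lef_pV2 ?posrE//.
  by rewrite mulr_gt0 ?pow2_gt0.
by rewrite pow2_gt0.
Qed.

Lemma interpolation_norm_le (theta : R) r : (0 < theta)%R -> 0 < r ->
  exists2 C : R, (0 < C)%R & forall f,
    interpolation_norm mu X0 X1 theta r f <= C%:E * seqnorm r (dyadic_K theta
      f).
Proof.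
move=> th0 r0; have [D D0 HD] := seqnorm_le_scale r0.
exists (D * 2)%R => [|f]; first exact: mulr_gt0.
pose x j := 2%:E * dyadic_K theta f j.
have x0 j : 0 <= x j by rewrite mule_ge0// dyadic_K_ge0.
apply: (le_trans _ (HD 2%R x _ _ x0 (dyadic_K_ge0 theta f) (fun=> lexx _))) =>
  //.
apply: normL_le_seqnorm => // j t jt; have t0 := dyadic_gt0 jt.
rewrite gee0_abs; last by rewrite mule_ge0 ?lee_fin ?powR_ge0// Kfun_ge0// ltW.
rewrite powR_split// EFinM -muleA; apply: lee_wpmul2l.
  by rewrite lee_fin powR_ge0.
rewrite /x /dyadic_K muleCA; apply: lee_pmul.
- by rewrite lee_fin powR_ge0.
- by rewrite Kfun_ge0// ltW.
- by rewrite lee_fin; exact: (powRN_dyadic _ jt).2.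
- apply: Kfun_le; rewrite ?pow2_ge0 ?ler1n//.
  by move/dyadicP : jt => /andP[_ /ltW]; rewrite rmorphD/= addrC pow2D pow2_1.
Qed.

Lemma le_interpolation_norm (theta : R) r : (0 < theta)%R -> 0 < r ->
  exists2 C : R, (0 < C)%R & forall f,
    seqnorm r (dyadic_K theta f) <= C%:E * interpolation_norm mu X0 X1 theta r
      f.
Proof.
move=> th0 r0; have [D D0 HD] := seqnorm_le_scale r0.
exists (D * pow2 theta * pow2 (fine r^-1))%R => [|f].
  by rewrite !mulr_gt0 ?pow2_gt0.
pose x j := (pow2 (- theta))%:E * dyadic_K theta f j.
have x0 j : 0 <= x j by rewrite mule_ge0 ?lee_fin ?pow2_ge0 ?dyadic_K_ge0.
apply: le_trans (HD (pow2 theta) _ x (pow2_gt0 _) (dyadic_K_ge0 theta f) x0 _)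
  _.
  by move=> j; rewrite /x muleA -EFinM -pow2D subrr pow2_0 mul1e.
rewrite [in leRHS]EFinM -muleA; apply: lee_wpmul2l.
  by rewrite lee_fin mulr_ge0 ?pow2_ge0// ltW.
apply: seqnorm_le_normL => // j t jt; have t0 := dyadic_gt0 jt.
rewrite gee0_abs; last by rewrite mule_ge0 ?lee_fin ?powR_ge0// Kfun_ge0// ltW.
rewrite powR_split// [in leRHS]EFinM -muleA; apply: lee_wpmul2l.
  by rewrite lee_fin powR_ge0.
rewrite /x /dyadic_K muleA -EFinM; apply: lee_pmul.
- by rewrite lee_fin mulr_ge0 ?pow2_ge0.
- by rewrite Kfun_ge0// pow2_ge0.
- by rewrite lee_fin; exact: (powRN_dyadic _ jt).1.
- rewrite -[leRHS]mul1e; apply: Kfun_le; rewrite ?(ltW t0)// mul1r.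
  by move/dyadicP : jt => /andP[].
Qed.

End Kfun_monotone.

End interpolation.

(** * The K-functional from below, and the first embedding *)

Section interpolation_embeddings.
Context {d : measure_display} {T : measurableType d} {R : realType}.
Variable mu : {measure set T -> \bar R}.
Implicit Types (f : T -> R) (k l m j : int).
Local Open Scope ereal_scope.

(** Splitting 2^k into two equal halves evaluates rearrangements at 2^(k-1); the shift costs a
    constant because [u] is slow. *)
Lemma dominated_below_pred (X : qspace R T) (s : R) (u : int -> R) :
  dominated_below mu X s u -> slow u ->
  exists2 C : R, (0 < C)%R & forall f k,
    (pow2 (s * k%:~R + u k))%:E * dyadic_rearr mu f (k - 1) <= C%:E * qnorm X f.
Proof.
move=> [C C0 HC] su; have [N HN] := su 1%R ltr01.
exists (pow2 (s + 1 + N) * C)%R => [|f k]; first by rewrite mulr_gt0 ?pow2_gt0.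
rewrite EFinM -muleA; apply: le_trans (lee_wpmul2l _ (HC f (k - 1)%R));
  last first.
  by rewrite lee_fin pow2_ge0.
rewrite muleA -EFinM; apply: lee_wpmul2r; first exact: dyadic_rearr_ge0.
rewrite lee_fin -pow2D ler_pow2.
have := HN k (k - 1)%R; rewrite zdistC zdist_le ?gerBl// rmorphB/= => h.
by rewrite mulrBr mulr1; lra.
Qed.

Section below.
Context (X0 X1 : qspace R T) (s0 s1 theta : R) (u0 u1 : int -> R).
Hypothesis X0_ge0 : forall f, 0 <= qnorm X0 f.
Hypothesis X1_ge0 : forall f, 0 <= qnorm X1 f.
Hypothesis mX0 : forall f, carrier X0 f -> measurable_fun setT f.
Hypothesis mX1 : forall f, carrier X1 f -> measurable_fun setT f.

(** The argument of K is the ratio of the two weights at scale [k], which makes both terms of any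
    decomposition count equally against f^*(2^k). *)
Lemma le_Kfun : dominated_below mu X0 s0 u0 -> dominated_below mu X1 s1 u1 ->
  slow u0 -> slow u1 ->
  exists2 C : R, (0 < C)%R & forall f k, measurable_fun setT f ->
    (pow2 (s0 * k%:~R + u0 k))%:E * dyadic_rearr mu f k <=
    C%:E * Kfun mu X0 X1 (pow2 ((s0 - s1) * k%:~R + u0 k - u1 k)) f.
Proof.
move=> /dominated_below_pred H0 /dominated_below_pred H1 /H0[C C0 HC] /H1[D D0
  HD].
exists (C + D)%R => [|f k mf]; first exact: addr_gt0.
have CD0 : (0 < C + D)%R by exact: addr_gt0.
rewrite -lee_pdivrMl//; apply: le_ereal_inf_tmp => _ [[g h] [/= Xg Xh fgh] <-].
rewrite lee_pdivrMl//=; set w := pow2 (_ - _).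
have w0 : (0 < w)%R by exact: pow2_gt0.
have -> : dyadic_rearr mu f k = rearrangement mu f (pow2 (k - 1)%:~R + pow2 (k
  - 1)%:~R)%R.
  congr rearrangement; rewrite rmorphB/= pow2D pow2N pow2_1; lra.
have h1 := rearrangementD (pow2 (k - 1)%:~R) (pow2 (k - 1)%:~R) mf (mX0 Xg)
  (mX1 Xh) fgh.
have e0 : 0 <= (pow2 (s0 * k%:~R + u0 k))%:E :> \bar R by rewrite lee_fin
  pow2_ge0.
apply: le_trans (lee_wpmul2l e0 h1) _.
rewrite ge0_muleDr ?rearrangement_ge0// ge0_muleDr ?mule_ge0 ?lee_fin//;
  last exact: ltW.
apply: leeD.
  apply: le_trans (HC g k) _; apply: lee_wpmul2r => //.
  by rewrite lee_fin lerDl ltW.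
have -> : pow2 (s0 * k%:~R + u0 k) = (w * pow2 (s1 * k%:~R + u1 k))%R.
  by rewrite /w -pow2D; congr pow2; ring.
rewrite EFinM -muleA [leRHS]muleCA; apply: lee_wpmul2l;
  first by rewrite lee_fin ltW.
apply: le_trans (HD h k) _; apply: lee_wpmul2r => //.
by rewrite lee_fin lerDr ltW.
Qed.

Hypothesis s1_lt_s0 : (s1 < s0)%R.
Hypothesis theta01 : (0 < theta < 1)%R.
Hypothesis u0_slow : slow u0.
Hypothesis u1_slow : slow u1.

Let w k := ((s0 - s1) * k%:~R + u0 k - u1 k)%R.

Definition dyadic_LK f k : \bar R :=
  (pow2 (((1 - theta) * s0 + theta * s1) * k%:~R
       + ((1 - theta) * u0 k + theta * u1 k)))%:E * dyadic_rearr mu f k.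

Lemma dyadic_LK_ge0 f k : 0 <= dyadic_LK f k.
Proof. by rewrite mule_ge0 ?lee_fin ?pow2_ge0 ?dyadic_rearr_ge0. Qed.

(** K is sampled at the integer part [J k] of [w k], at the cost of a factor 2. Slopes of [w] are
    bounded below, so [J] is quasi-expanding and the Schur test, used at [l = J k] only, bounds the
    multiplicity of the samples. *)
Lemma seqnorm_dyadic_LK_le r : 0 < r ->
  dominated_below mu X0 s0 u0 -> dominated_below mu X1 s1 u1 ->
  exists2 C : R, (0 < C)%R & forall f, measurable_fun setT f ->
    seqnorm r (dyadic_LK f) <= C%:E * interpolation_norm mu X0 X1 theta r f.
Proof.
move=> r0 below0 below1; have /andP[th0 th1] := theta01.
have [C C0 HC] := le_Kfun below0 below1 u0_slow u1_slow.
have [D D0 HD] := le_interpolation_norm mu X0_ge0 X1_ge0 th0 r0.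
have a0 : (0 < s0 - s1)%R by rewrite subr_gt0.
have [N wN] := quasi_increasing_slow a0 u0_slow u1_slow.
pose J k := Num.floor (w k).
have JE k : ((J k)%:~R <= w k <= (J k)%:~R + 1)%R.
  have /andP[h1 /ltW h2] := floor_itv (w k).
  by rewrite h1/=; move: h2; rewrite rmorphD.
have Jexp := quasi_expanding_floor wN JE.
have a2 : (0 < (s0 - s1) / 2)%R by exact: divr_gt0.
have [E E0 HE] := seqnorm_schur (N + 1) r0 ltr01 a2.
exists (E * (C * 2) * D)%R => [|f mf]; first by rewrite !mulr_gt0.
apply: (@le_trans _ _ ((E * (C * 2))%:E * seqnorm r (dyadic_K mu X0 X1 theta
  f))); last first.
  rewrite [in leRHS]EFinM -muleA; apply: lee_wpmul2l (HD f).
  by rewrite lee_fin !mulr_ge0// ltW.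
apply: (HE J) => //.
- by rewrite mulr_gt0.
- exact: dyadic_LK_ge0.
- exact: dyadic_K_ge0.
move=> k A A0 /(_ (J k)); rewrite zdistxx mulr0 pow2_0 mul1e => FA.
have /andP[Jw wJ] := JE k.
rewrite EFinM; apply: le_trans (lee_wpmul2l _ FA); last first.
  by rewrite lee_fin mulr_ge0// ltW.
rewrite /dyadic_LK.
have -> : pow2 (((1 - theta) * s0 + theta * s1) * k%:~R + ((1 - theta) * u0 k +
  theta * u1 k)) =
    (pow2 (- theta * w k) * pow2 (s0 * k%:~R + u0 k))%R.
  by rewrite -pow2D /w; congr pow2; ring.
rewrite EFinM -muleA /dyadic_K.
apply: (@le_trans _ _ ((pow2 (- theta * (J k)%:~R))%:E * (C%:E * (2%:E * Kfun
  mu X0 X1 (pow2 (J k)%:~R) f)))).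
  apply: lee_pmul.
  - by rewrite lee_fin pow2_ge0.
  - by rewrite mule_ge0 ?lee_fin ?pow2_ge0 ?dyadic_rearr_ge0.
  - by rewrite lee_fin ler_pow2 !mulNr lerN2 ler_pM2l.
  apply: le_trans (HC f k mf) _; apply: lee_wpmul2l;
    first by rewrite lee_fin ltW.
  apply: Kfun_le; rewrite ?pow2_ge0 ?ler1n//.
  by rewrite -/(w k) -[X in (X * _)%R]pow2_1 -pow2D ler_pow2 addrC.
by rewrite [leLHS]muleCA [in leRHS]EFinM -muleA [X in _ <= _ * X]muleCA.
Qed.

End below.
End interpolation_embeddings.

(** * Truncation and the second embedding *)

Section decomposition.
Context {d : measure_display} {T : measurableType d} {R : realType}.
Variable mu : {measure set T -> \bar R}.
Implicit Types (f : T -> R) (k l m j : int).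
Local Open Scope ereal_scope.

Context (X0 X1 : qspace R T) (s0 s1 theta : R) (u0 u1 : int -> R).
Hypothesis X0_ge0 : forall f, 0 <= qnorm X0 f.
Hypothesis X1_ge0 : forall f, 0 <= qnorm X1 f.
Hypothesis X0_carrier : forall f,
  measurable_fun setT f -> qnorm X0 f < +oo -> carrier X0 f.
Hypothesis X1_carrier : forall f,
  measurable_fun setT f -> qnorm X1 f < +oo -> carrier X1 f.
Hypothesis s1_gt0 : (0 < s1)%R.
Hypothesis s1_lt_s0 : (s1 < s0)%R.
Hypothesis theta01 : (0 < theta < 1)%R.
Hypothesis u0_slow : slow u0.
Hypothesis u1_slow : slow u1.
Hypothesis above0 : dominated_above mu X0 s0 u0.
Hypothesis above1 : dominated_above mu X1 s1 u1.

Let s := ((1 - theta) * s0 + theta * s1)%R.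
Let v k := ((1 - theta) * u0 k + theta * u1 k)%R.
Let w k := ((s0 - s1) * k%:~R + u0 k - u1 k)%R.
Let LK := dyadic_LK mu s0 s1 theta u0 u1.

Lemma slow_convex : slow v.
Proof.
move=> e e0; have [M HM] := u0_slow e0; have [N HN] := u1_slow e0.
have /andP[th0 th1] := theta01.
exists ((1 - theta) * M + theta * N)%R => k m; rewrite /v.
have h1 : ((1 - theta) * u0 k <= (1 - theta) * (u0 m + e * zdist k m + M))%R.
  by apply: ler_wpM2l => //; rewrite subr_ge0 ltW.
have h2 : (theta * u1 k <= theta * (u1 m + e * zdist k m + N))%R.
  by apply: ler_wpM2l => //; exact: ltW.
lra.
Qed.

(** The exponent [2 * e] has two sources: the hypothesis on [LK f l], and the replacement of [v l]
    by [v k]. *)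
Lemma dyadic_rearr_bound (e : R) : (0 < e)%R -> exists N : R, forall f k A,
  (0 < A)%R -> (forall l, (pow2 (- e * zdist l k))%:E * LK f l <= A%:E) ->
  forall l, dyadic_rearr mu f l <=
    (A * pow2 (2 * e * zdist l k - s * l%:~R - v k + N))%:E.
Proof.
move=> e0; have [N HN] := slow_convex e0; exists N => f k A A0 H l.
have := H l; rewrite /LK /dyadic_LK -/s -/(v l) muleA -EFinM -pow2D.
rewrite -lee_pdivlMl ?pow2_gt0// -pow2N -EFinM mulrC => /le_trans; apply.
rewrite lee_fin ler_pM2l// ler_pow2.
by have := HN k l; rewrite (zdistC k l); lra.
Qed.

(** The cut is at height f^*(2^k). The part above it has vanishing rearrangement from 2^k on, and
    before 2^k its weight grows at rate theta a. The part below it is constant-bounded before 2^k,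
    where s1 > 0 gives decay, and after 2^k it decays at rate (1 - theta) a. *)
Lemma decomposition_bound : exists e C : R, [/\ (0 < e)%R, (0 < C)%R &
  forall f k A, measurable_fun setT f -> (0 < A)%R ->
    (forall l, (pow2 (- e * zdist l k))%:E * LK f l <= A%:E) ->
    exists g, [/\ decomposition mu X0 X1 f g,
      qnorm X0 g.1 <= (C * (A * pow2 (theta * w k)))%:E &
      qnorm X1 g.2 <= (C * (A * pow2 (- (1 - theta) * w k)))%:E]].
Proof.
have /andP[th0 th1] := theta01.
have a0 : (0 < s0 - s1)%R by rewrite subr_gt0.
set a := (s0 - s1)%R in a0.
have a1 : (0 < theta * a)%R by exact: mulr_gt0.
have a2 : (0 < (1 - theta) * a)%R by rewrite mulr_gt0// subr_gt0.
(* A loss of 2e in the bound on f^* and a required decay e need 3e below the two rates containing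
   [a]; the bounded part needs e <= s1. The quarter leaves room. *)
pose e := (Num.min s1 (Num.min (theta * a) ((1 - theta) * a)) / 4)%R.
have e0 : (0 < e)%R by rewrite divr_gt0// !lt_min s1_gt0 a1.
have e1 : (4 * e <= s1)%R by rewrite /e mulrC divfK// ge_min lexx.
have e2' : (4 * e <= theta * a)%R by rewrite /e mulrC divfK// !ge_min lexx orbT.
have e3 : (4 * e <= (1 - theta) * a)%R by rewrite /e mulrC divfK// !ge_min lexx
  !orbT.
have [N HN] := dyadic_rearr_bound e0.
have [C C0 HC] := above0 e0; have [D D0 HD] := above1 e0.
exists e, ((C + D) * pow2 N)%R; split => //.
  by rewrite mulr_gt0 ?pow2_gt0// addr_gt0.
move=> f k A mf A0 H; have {}HN := HN f k A A0 H.
(* [HN] bounds f^*(2^k) by a real, so an infinite truncation height is impossible. *)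
have [fkE|[lam lam0 fkE]] := poweR_real_ge0 (dyadic_rearr_ge0 mu f k).
  by have := HN k; rewrite fkE.
have lamle : (lam <= A * pow2 (- s * k%:~R - v k + N))%R.
  rewrite -lee_fin -fkE; have := HN k; rewrite zdistxx mulr0 sub0r.
  by rewrite mulNr.
pose h1 x := clip lam (f x); pose h0 x := (f x - h1 x)%R.
have mh1 : measurable_fun setT h1 by exact: measurable_clip.
have mh0 : measurable_fun setT h0 by exact: measurable_funB.
pose B0 := (A * pow2 (theta * a * k%:~R - v k + N))%R.
have B00 : (0 < B0)%R by rewrite mulr_gt0// pow2_gt0.
pose B1 := (A * pow2 (- (1 - theta) * a * k%:~R - v k + N))%R.
have B10 : (0 < B1)%R by rewrite mulr_gt0// pow2_gt0.
have N0 : qnorm X0 h0 <= (C * (B0 * pow2 (u0 k)))%:E.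
  apply: HC => // l; have [kl|lk] := leP k l.
    apply: (@le_trans _ _ 0); last by rewrite lee_fin mulr_ge0 ?pow2_ge0// ltW.
    apply: mule_ge0_le0; first by rewrite lee_fin pow2_ge0.
    apply: (le_trans (dyadic_rearr_le mu h0 kl)).
    by apply: rearrangement_subclip => //; exact: measure_level_rearrangement.
  apply: (@le_trans _ _ ((pow2 (s0 * l%:~R))%:E * (A * pow2 (2 * e * zdist l k
    - s * l%:~R - v k + N))%:E)).
    apply: lee_wpmul2l; first by rewrite lee_fin pow2_ge0.
    apply: le_trans (HN l); apply: rearrangement_mono => // x.
    by have [] := clipP (f x) lam0.
  rewrite -EFinM lee_fin mulrCA /B0 -[leRHS]mulrA ler_pM2l// -!pow2D ler_pow2.
  have dl : (l%:~R = k%:~R - zdist l k :> R)%R by rewrite (zdist_le (ltW lk));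
    lra.
  have dg := zdist_ge0 (R := R) l k; rewrite dl /s /a.
  have : ((4 * e) * zdist l k <= theta * a * zdist l k)%R by exact: ler_wpM2r.
  have : (0 <= e * zdist l k)%R by rewrite mulr_ge0// ltW.
  rewrite /a; lra.
have N1 : qnorm X1 h1 <= (D * (B1 * pow2 (u1 k)))%:E.
  apply: HD => // l; have dg := zdist_ge0 (R := R) l k.
  have ed : (0 <= e * zdist l k)%R by rewrite mulr_ge0// ltW.
  have [kl|lk] := leP k l.
    apply: (@le_trans _ _ ((pow2 (s1 * l%:~R))%:E * (A * pow2 (2 * e * zdist l
      k - s * l%:~R - v k + N))%:E)).
      apply: lee_wpmul2l; first by rewrite lee_fin pow2_ge0.
      apply: le_trans (HN l); apply: rearrangement_mono => // x.
      by have [] := clipP (f x) lam0.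
    rewrite -EFinM lee_fin mulrCA /B1 -[leRHS]mulrA ler_pM2l// -!pow2D ler_pow2.
    have dl : (l%:~R = k%:~R + zdist l k :> R)%R by rewrite zdistC (zdist_le
      kl); lra.
    have : ((4 * e) * zdist l k <= (1 - theta) * a * zdist l k)%R by exact:
      ler_wpM2r.
    rewrite dl /s /a; lra.
  apply: (@le_trans _ _ ((pow2 (s1 * l%:~R))%:E * lam%:E)).
    apply: lee_wpmul2l; first by rewrite lee_fin pow2_ge0.
    by apply: rearrangement_clip => //; exact: pow2_ge0.
  rewrite -EFinM lee_fin; apply: le_trans (ler_wpM2l (pow2_ge0 _) lamle) _.
  rewrite mulrCA /B1 -[leRHS]mulrA ler_pM2l// -!pow2D ler_pow2.
  have dl : (l%:~R = k%:~R - zdist l k :> R)%R by rewrite (zdist_le (ltW lk));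
    lra.
  have : ((4 * e) * zdist l k <= s1 * zdist l k)%R by exact: ler_wpM2r.
  rewrite dl /s /a; lra.
exists (h0, h1) => /=; split.
- split => /=.
  + by apply: X0_carrier => //; apply: le_lt_trans N0 (ltry _).
  + by apply: X1_carrier => //; apply: le_lt_trans N1 (ltry _).
  + by apply: nearW => x; rewrite /h0 subrK.
- apply: le_trans N0 _; rewrite lee_fin.
  (* Uses u0 - v = theta (u0 - u1); for the other piece, u1 - v = -(1 - theta)(u0 - u1). *)
  have -> : (B0 * pow2 (u0 k) = pow2 N * (A * pow2 (theta * w k)))%R.
    by rewrite /B0 mulrCA -!mulrA -!pow2D /v /w /a; congr (_ * pow2 _)%R; ring.
  rewrite -[leRHS]mulrA; apply: ler_wpM2r.
    by apply: ltW; apply: mulr_gt0 (pow2_gt0 _) _; exact: mulr_gt0 (pow2_gt0 _).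
  by rewrite lerDl ltW.
- apply: le_trans N1 _; rewrite lee_fin.
  have -> : (B1 * pow2 (u1 k) = pow2 N * (A * pow2 (- (1 - theta) * w k)))%R.
    by rewrite /B1 mulrCA -!mulrA -!pow2D /v /w /a; congr (_ * pow2 _)%R; ring.
  rewrite -[leRHS]mulrA; apply: ler_wpM2r.
    by apply: ltW; apply: mulr_gt0 (pow2_gt0 _) _; exact: mulr_gt0 (pow2_gt0 _).
  by rewrite lerDr ltW.
Qed.

Lemma decomposition_exists r f : 0 < r -> measurable_fun setT f ->
  seqnorm r (LK f) < +oo -> exists g, decomposition mu X0 X1 f g.
Proof.
move=> r0 mf fin; have [e [C [e0 C0 H]]] := decomposition_bound.
have LK0 := dyadic_LK_ge0 mu s0 s1 theta u0 u1 f.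
have L0 := seqnorm_ge0 r LK0.
have A0 : (0 < fine (seqnorm r (LK f)) + 1)%R by rewrite ltr_wpDl// fine_ge0.
(* Any scale would do for mere existence; adding 1 to the norm makes the bound [A] positive. *)
have [|g [gD _ _]] := H f 0%R _ mf A0; last by exists g.
move=> l; apply: (@le_trans _ _ (1 * seqnorm r (LK f))).
  apply: lee_pmul => //.
  - by rewrite lee_fin pow2_ge0.
  - by rewrite lee_fin -pow2_0 ler_pow2 mulNr oppr_le0 mulr_ge0 ?zdist_ge0//
      ltW.
  - exact: seqnorm_ge_term.
by rewrite mul1e -[leLHS]fineK ?ge0_fin_numE// lee_fin lerDl.
Qed.

(** At 2^j the function is truncated at the scale [t j], with w(t j) <= j <= w(t j) + b + N. After
    multiplication by 2^(-theta j), the first piece contributes at most a multiple of A, and the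
    second the same up to 2^((1-theta)(b+N)). *)
Lemma interpolation_norm_le_seqnorm r : 0 < r ->
  exists2 C : R, (0 < C)%R & forall f, measurable_fun setT f ->
    interpolation_norm mu X0 X1 theta r f <= C%:E * seqnorm r (LK f).
Proof.
move=> r0; have /andP[th0 th1] := theta01.
have [e [C [e0 C0 H]]] := decomposition_bound.
have [D D0 HD] := interpolation_norm_le mu X0_ge0 X1_ge0 th0 r0.
have a0 : (0 < s0 - s1)%R by rewrite subr_gt0.
have [N wN] := quasi_increasing_slow a0 u0_slow u1_slow.
have a2 : (0 < (s0 - s1) / 2)%R by exact: divr_gt0.
have b0 : (0 < 2 * (s0 - s1))%R by exact: mulr_gt0.
have [t [tE texp]] := quasi_inverse a2 b0 wN.
set b := (2 * (s0 - s1))%R in b0 tE texp.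
have bV0 : (0 < b^-1)%R by rewrite invr_gt0.
have [E E0 HE] := seqnorm_schur ((2 * (b + N) + N) / b) r0 e0 bV0.
pose K := (C * (1 + pow2 ((1 - theta) * (b + N))))%R.
have K0 : (0 < K)%R by rewrite mulr_gt0// addr_gt0// pow2_gt0.
exists (D * (E * K))%R => [|f mf].
  by apply: mulr_gt0 => //; exact: mulr_gt0.
apply: le_trans (HD f) _; rewrite EFinM -muleA; apply: lee_wpmul2l.
  by rewrite lee_fin ltW.
apply: (HE t) => //.
- exact: dyadic_K_ge0.
- exact: dyadic_LK_ge0.
move=> j A A0 HA; have [g [gD g0 g1]] := H f (t j) A mf A0 HA.
have /andP[h1 h2] := tE j.
set W := w (t j) in g0 g1 h1 h2.
apply: (@le_trans _ _ ((pow2 (- theta * j%:~R))%:E *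
    ((C * (A * pow2 (theta * W)))%:E + (pow2 j%:~R)%:E * (C * (A * pow2 (- (1 -
      theta) * W)))%:E))).
  apply: lee_wpmul2l; first by rewrite lee_fin pow2_ge0.
  apply: (@le_trans _ _ (qnorm X0 g.1 + (pow2 j%:~R)%:E * qnorm X1 g.2)).
    by apply: ereal_inf_lbound; exists g.
  by apply: leeD => //; apply: lee_wpmul2l => //; rewrite lee_fin pow2_ge0.
rewrite -[(pow2 j%:~R)%:E * _]EFinM -EFinD -EFinM lee_fin /K.
have -> : (pow2 (- theta * j%:~R) * (C * (A * pow2 (theta * W)) +
    pow2 j%:~R * (C * (A * pow2 (- (1 - theta) * W)))) =
  C * A * (pow2 (- theta * j%:~R) * pow2 (theta * W) +
    pow2 (- theta * j%:~R) * pow2 j%:~R * pow2 (- (1 - theta) * W)))%R by ring.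
rewrite [leRHS]mulrAC ler_pM2l ?mulr_gt0// -!pow2D; apply: lerD.
  rewrite -[leRHS]pow2_0 ler_pow2.
  have : (theta * W <= theta * j%:~R)%R by rewrite ler_pM2l.
  lra.
rewrite ler_pow2.
have : ((1 - theta) * j%:~R <= (1 - theta) * (W + (b + N)))%R.
  by rewrite ler_pM2l// subr_gt0.
lra.
Qed.

End decomposition.

(** * Discretization of the Lorentz-Karamata norm *)

Section Lorentz_Karamata_norm.
Context {d : measure_display} {T : measurableType d} {R : realType}.
Variable mu : {measure set T -> \bar R}.
Implicit Types (f : T -> R) (k l m j : int).
Local Open Scope ereal_scope.

Lemma powR_mul_dyadic (s C : R) (a : R -> R) (v : int -> R) k t :
  (0 < s)%R -> (0 < C)%R ->
  (a t <= C * pow2 (v k) /\ pow2 (v k) <= C * a t)%R -> dyadic k t ->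
  (t `^ s * a t <= pow2 s * C * pow2 (s * k%:~R + v k) /\
   pow2 (s * k%:~R + v k) <= C * (t `^ s * a t))%R.
Proof.
move=> s0 C0 [h1 h2] kt; have [h3 h4] := dyadic_powR (ltW s0) kt.
have t0 := dyadic_gt0 kt; have ts : (0 < t `^ s)%R by exact: powR_gt0.
have a0 : (0 < a t)%R.
  by rewrite -(pmulr_rgt0 _ C0); exact: lt_le_trans (pow2_gt0 _) h2.
rewrite pow2D; split.
  rewrite (_ : _ * (_ * _) = pow2 s * pow2 (s * k%:~R) * (C * pow2 (v k)))%R;
    last by ring.
  by apply: ler_pM => //; exact: ltW.
by rewrite mulrCA; apply: ler_pM => //; exact: pow2_ge0.
Qed.

Context (s C : R) (r : \bar R) (a : R -> R) (v : int -> R).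
Hypothesis s_gt0 : (0 < s)%R.
Hypothesis r_gt0 : 0 < r.
Hypothesis C_gt0 : (0 < C)%R.
Hypothesis aE : forall k t, dyadic k t ->
  (a t <= C * pow2 (v k) /\ pow2 (v k) <= C * a t)%R.

Let LK f k := (pow2 (s * k%:~R + v k))%:E * dyadic_rearr mu f k.

Let norm f := normL r `]0%R, +oo[
  (fun t => (t `^ (s - fine r^-1) * a t)%:E * rearrangement mu f t).

Let a_ge0 t : (0 < t)%R -> (0 <= a t)%R.
Proof.
move=> /dyadic_dlog/aE[_ h].
rewrite -(pmulr_rge0 _ C_gt0); exact: le_trans (pow2_ge0 _) h.
Qed.

Let LK_ge0 f k : 0 <= LK f k.
Proof. by rewrite mule_ge0 ?lee_fin ?pow2_ge0 ?dyadic_rearr_ge0. Qed.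

Let integrandE f t : (0 < t)%R ->
  `|(t `^ (s - fine r^-1) * a t)%:E * rearrangement mu f t| =
  (t `^ (- fine r^-1))%:E * ((t `^ s * a t)%:E * rearrangement mu f t).
Proof.
move=> t0; rewrite gee0_abs; last first.
  by rewrite mule_ge0 ?rearrangement_ge0// lee_fin mulr_ge0 ?powR_ge0 ?a_ge0.
by rewrite powR_split// muleA -EFinM mulrA.
Qed.

Lemma LK_norm_le_seqnorm : exists2 D : R, (0 < D)%R &
  forall f, norm f <= D%:E * seqnorm r (LK f).
Proof.
have [D D0 HD] := seqnorm_le_scale r_gt0.
have K0 : (0 < pow2 s * C)%R by rewrite mulr_gt0 ?pow2_gt0.
exists (D * (pow2 s * C))%R => [|f]; first exact: mulr_gt0.
pose x k := (pow2 s * C)%:E * LK f k.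
have x0 k : 0 <= x k by apply: mule_ge0 (LK_ge0 f k); rewrite lee_fin ltW.
apply: (le_trans _ (HD _ x _ K0 x0 (LK_ge0 f) (fun=> lexx _))).
apply: normL_le_seqnorm => // k t kt; have t0 := dyadic_gt0 kt.
rewrite integrandE//; apply: lee_wpmul2l; first by rewrite lee_fin powR_ge0.
rewrite /x /LK muleA -EFinM; apply: lee_pmul.
- by rewrite lee_fin mulr_ge0 ?powR_ge0 ?a_ge0.
- exact: rearrangement_ge0.
- by rewrite lee_fin; exact: (powR_mul_dyadic s_gt0 C_gt0 (aE kt) kt).1.
- exact: (rearrangement_dyadic mu f kt).1.
Qed.

(** On the k-th interval f^* is only bounded below by f^*(2^(k+1)), so the sequence obtained is
    shifted by one; slowness of [v] moves the weight. *)
Lemma seqnorm_le_LK_norm : slow v -> exists2 D : R, (0 < D)%R &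
  forall f, seqnorm r (LK f) <= D%:E * norm f.
Proof.
move=> /(_ _ ltr01)[N HN].
have [D D0 HD] := seqnorm_schur_id r_gt0 (@ltr01 R).
pose M := (pow2 (s + 1 + N) * C)%R.
have M0 : (0 < M)%R by rewrite mulr_gt0 ?pow2_gt0.
have K0 : (0 < pow2 1 * M)%R by rewrite mulr_gt0 ?pow2_gt0.
exists (D * (pow2 1 * M) * pow2 (fine r^-1))%R => [|f].
  by apply: mulr_gt0; [exact: mulr_gt0|exact: pow2_gt0].
pose y k := M^-1%:E * LK f (k + 1).
have y0 k : 0 <= y k.
  by apply: mule_ge0 (LK_ge0 f _); rewrite lee_fin invr_ge0 ltW.
apply: le_trans (HD _ (LK f) y K0 (LK_ge0 f) y0 _) _.
  (* The Schur test undoes the shift: [l = j - 1] is at distance 1, whence the factor [pow2 1]. *)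
  move=> j A A0 /(_ (j - 1)%R); rewrite /y subrK zdist_le ?gerBl// rmorphB/=.
  rewrite opprB addrCA subrr addr0 mulr1 muleA -[_%:E * _%:E]EFinM.
  rewrite -lee_pdivlMl ?mulr_gt0 ?pow2_gt0 ?invr_gt0// => /le_trans; apply.
  by rewrite -EFinM lee_fin pow2N -invfM invrK.
rewrite [in leRHS]EFinM -muleA; apply: lee_wpmul2l.
  by rewrite lee_fin ltW// mulr_gt0.
apply: seqnorm_le_normL => // k t kt; have t0 := dyadic_gt0 kt.
rewrite integrandE//; apply: lee_wpmul2l; first by rewrite lee_fin powR_ge0.
rewrite /y /LK muleA -EFinM; apply: lee_pmul.
- by rewrite lee_fin mulr_ge0 ?pow2_ge0// invr_ge0 ltW.
- exact: dyadic_rearr_ge0.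
- rewrite lee_fin ler_pdivrMl//.
  have := (powR_mul_dyadic s_gt0 C_gt0 (aE kt) kt).2 => h.
  rewrite /M -mulrA; apply: le_trans (ler_wpM2l (pow2_ge0 _) h).
  rewrite -pow2D ler_pow2 rmorphD/= mulrDr mulr1.
  have kk : (k <= k + 1)%R by rewrite lerDl.
  have := HN (k + 1)%R k; rewrite zdistC (zdist_le kk) rmorphD/= => h1.
  lra.
- exact: (rearrangement_dyadic mu f kt).2.
Qed.

End Lorentz_Karamata_norm.

(** * Small Lorentz spaces as instances of the two-sided domination *)

Section small_Lorentz_dominated.
Context {d : measure_display} {T : measurableType d} {R : realType}.
Variable mu : {measure set T -> \bar R}.
Local Open Scope ereal_scope.

Lemma small_Lorentz_dominated (p : R) (q r : \bar R) (b : R -> R) :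
  (0 < p)%R -> 0 < q -> 0 < r -> slowly_varying b -> tail_norm r b 1 < +oo ->
  exists2 u : int -> R, slow u &
    [/\ dominated_below mu (small_Lorentz mu p q r b) p^-1 u,
        dominated_above mu (small_Lorentz mu p q r b) p^-1 u &
        exists2 C : R, (0 < C)%R & forall k t, dyadic k t ->
          (fine (tail_norm r b t) <= C * pow2 (u k) /\
           pow2 (u k) <= C * fine (tail_norm r b t))%R].
Proof.
move=> p0 q0 r0 bSV b1; have [g [gSV gE [C C0 gC]]] := tail_sequence r0 bSV b1.
have [u us ugE] := sv_seq_slow gSV; exists u => //; split.
- have [D D0 HD] := small_Lorentz_norm_lower mu p0 q0 r0 bSV gE gSV.1.
  by exists D => // f k; have := HD f k; rewrite ugE pow2D.
- move=> e e0; have [D D0 HD] := small_Lorentz_norm_upper mu p0 q0 r0 bSV gE e0.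
  by exists D => // f k B B0 H; rewrite -ugE; exact: HD.
- by exists C => // k t kt; rewrite -ugE; exact: gC.
Qed.

End small_Lorentz_dominated.

(** * The interpolation theorem *)

Theorem corollary49 (R : realType) (d : measure_display)
    (T : measurableType d) (mu : {measure set T -> \bar R})
    (mu_sigma_finite : sigma_finite [set: T] mu) (mu_nonatomic : nonatomic mu)
    (theta p0 p1 p : R) (r r0 r1 q0 q1 : \bar R) (b0 b1 : R -> R)
    (theta_gt0 : 0 < theta) (theta_lt1 : theta < 1)
    (p0_gt1 : 1 < p0) (p0_lt_p1 : p0 < p1)
    (r_gt0 : (0 < r)%E) (r0_gt0 : (0 < r0)%E) (r1_gt0 : (0 < r1)%E)
    (q0_gt0 : (0 < q0)%E) (q1_gt0 : (0 < q1)%E)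
    (b0_SV : slowly_varying b0) (b1_SV : slowly_varying b1)
    (b0_fin : (tail_norm r0 b0 1 < +oo)%E)
    (b1_fin : (tail_norm r1 b1 1 < +oo)%E)
    (pE : p^-1 = (1 - theta) / p0 + theta / p1) :
  let c0 := fun t : R => fine (tail_norm r0 b0 t) in
  let c1 := fun t : R => fine (tail_norm r1 b1 t) in
  let a_sharp := fun t : R => c0 t `^ (1 - theta) * c1 t `^ theta in
  same_space
    (real_interpolation mu (small_Lorentz mu p0 q0 r0 b0)
                           (small_Lorentz mu p1 q1 r1 b1) theta r)
    (Lorentz_Karamata mu p%:E r a_sharp).
Proof.
move=> c0 c1 a_sharp.
have p0_gt0 : 0 < p0 by exact: lt_trans p0_gt1.
have p1_gt0 : 0 < p1 by exact: lt_trans p0_lt_p1.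
have [u0 u0_slow [below0 above0 [C0 C0_gt0 c0E]]] :=
  small_Lorentz_dominated mu p0_gt0 q0_gt0 r0_gt0 b0_SV b0_fin.
have [u1 u1_slow [below1 above1 [C1 C1_gt0 c1E]]] :=
  small_Lorentz_dominated mu p1_gt0 q1_gt0 r1_gt0 b1_SV b1_fin.
set X0 := small_Lorentz mu p0 q0 r0 b0 in below0 above0 *.
set X1 := small_Lorentz mu p1 q1 r1 b1 in below1 above1 *.
have X0_ge0 f : (0 <= qnorm X0 f)%E by exact: normL_ge0.
have X1_ge0 f : (0 <= qnorm X1 f)%E by exact: normL_ge0.
have theta01 : 0 < theta < 1 by rewrite theta_gt0.
have s1_lt_s0 : p1^-1 < p0^-1 by rewrite ltf_pV2.
have s1_gt0 : 0 < p1^-1 by rewrite invr_gt0.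
(* Positivity of [p] follows from [pE]; it makes the inverse of [p%:E] the real inverse. *)
have s_gt0 : 0 < p^-1.
  by rewrite pE addr_gt0// divr_gt0// subr_gt0.
have pinv : fine (p%:E^-1) = p^-1.
  by rewrite inver gt_eqF// -invr_gt0.
pose v k := (1 - theta) * u0 k + theta * u1 k.
have v_slow : slow v by exact: slow_convex.
have vE k : pow2 (v k) = pow2 (u0 k) `^ (1 - theta) * pow2 (u1 k) `^ theta.
  by rewrite !pow2_powR -pow2D; congr pow2; rewrite /v; ring.
have th1 : 0 <= 1 - theta by rewrite subr_ge0 ltW.
have fine_ge0 r' b' t : 0 <= fine (tail_norm r' b' t).
  by apply: fine_ge0; exact: normL_ge0.
(* Geometric means preserve equivalence, and the constants combine with the same exponents. *)
have aE : forall k t, dyadic k t ->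
   a_sharp t <= C0 `^ (1 - theta) * C1 `^ theta * pow2 (v k) /\
   pow2 (v k) <= C0 `^ (1 - theta) * C1 `^ theta * a_sharp t.
  move=> k t kt; have [h0 h0'] := c0E _ _ kt; have [h1 h1'] := c1E _ _ kt.
  rewrite vE /a_sharp [X in _ <= X /\ _]mulrACA [X in _ /\ _ <= X]mulrACA.
  have C0' := ltW C0_gt0; have C1' := ltW C1_gt0.
  rewrite -!powRM ?pow2_ge0 ?fine_ge0//.
  by split; apply: ler_pM; rewrite ?powR_ge0//; apply: ge0_ler_powR;
    rewrite ?nnegrE ?mulr_ge0 ?pow2_ge0 ?fine_ge0 ?(ltW theta_gt0).
have C_gt0 : 0 < C0 `^ (1 - theta) * C1 `^ theta by rewrite mulr_gt0 ?powR_gt0.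
have [D D0 HD] := LK_norm_le_seqnorm mu s_gt0 r_gt0 C_gt0 aE.
have [E E0 HE] := seqnorm_le_LK_norm mu s_gt0 r_gt0 C_gt0 aE v_slow.
have LK_normE f : LK_norm mu p%:E r a_sharp f = normL r `]0%R, +oo[
  (fun t => (t `^ (p^-1 - fine r^-1) * a_sharp t)%:E * rearrangement mu f t)%E.
  by rewrite /LK_norm pinv.
have dyadic_LKE f : dyadic_LK mu p0^-1 p1^-1 theta u0 u1 f =
    (fun k => (pow2 (p^-1 * k%:~R + v k))%:E * dyadic_rearr mu f k)%E.
  by apply/funext => k; rewrite /dyadic_LK pE.
split.
- have [F F0 HF] := seqnorm_dyadic_LK_le X0_ge0 X1_ge0 (fun f => @proj1 _ _)
    (fun f => @proj1 _ _) s1_lt_s0 theta01 u0_slow u1_slow r_gt0 below0 below1.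
  exists (D * F) => [|f [mf _ finf]]; first exact: mulr_gt0.
  have H : (LK_norm mu p%:E r a_sharp f <=
      (D * F)%:E * interpolation_norm mu X0 X1 theta r f)%E.
    rewrite LK_normE; apply: le_trans (HD f) _; rewrite EFinM -muleA.
    apply: lee_wpmul2l; first by rewrite lee_fin ltW.
    by rewrite -dyadic_LKE; exact: HF.
  split => //; split => //; apply: le_lt_trans H _.
  by rewrite lte_mul_pinfty// ?lee_fin ?mulr_ge0// ltW.
- have X0_carrier f : measurable_fun setT f -> (qnorm X0 f < +oo)%E -> carrier
    X0 f by [].
  have X1_carrier f : measurable_fun setT f -> (qnorm X1 f < +oo)%E -> carrier
    X1 f by [].
  have [F F0 HF] := interpolation_norm_le_seqnorm X0_ge0 X1_ge0 X0_carrier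
    X1_carrier
    s1_gt0 s1_lt_s0 theta01 u0_slow u1_slow above0 above1 r_gt0.
  exists (F * E) => [|f [mf finf]]; first exact: mulr_gt0.
  have HEf := HE f; rewrite -LK_normE -dyadic_LKE in HEf.
  have H : (interpolation_norm mu X0 X1 theta r f <=
      (F * E)%:E * LK_norm mu p%:E r a_sharp f)%E.
    apply: le_trans (HF f mf) _; rewrite EFinM -muleA.
    by apply: lee_wpmul2l => //; rewrite lee_fin ltW.
  split => //; split => //.
  + apply: (decomposition_exists X0_carrier X1_carrier s1_gt0 s1_lt_s0
      theta01 u0_slow u1_slow above0 above1 r_gt0 mf).
    apply: le_lt_trans HEf _.
    by rewrite lte_mul_pinfty// ?lee_fin ltW.
  + apply: le_lt_trans H _.
    by rewrite lte_mul_pinfty// ?lee_fin ?mulr_ge0// ltW.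
Qed.
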